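(* Prop-CFD (given an instance of the connected fair division problem, does it admit a proportional valid allocation?) is solvable in polynomial time on instances whose graph $G$ is a star.
   Context: An instance of the connected fair division problem (CFD) is a triple $I=(G,N,\mathcal U)$ where $G=(V,E)$ is a finite undirected graph whose vertices are called items, $N=\{1,\dots,n\}$ is a set of players, and $\mathcal U=(u_1,\dots,u_n)$ with $u_i:V\to\mathbb Q_{\ge 0}$ and $\sum_{v\in V}u_i(v)=1$ for every $i$. Utilities are additive: $u_i(X)=\sum_{v\in X}u_i(v)$. An allocation $\pi:N\to 2^V$ is valid if each $\pi(i)$ induces a connected subgraph of $G$ and $\pi(i)\cap\pi(j)=\emptyset$ for $i\neq j$. A valid allocation is proportional if $u_i(\pi(i))\ge 1/n$ for all $i\in N$. *)

(* Defs.v *)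
From mathcomp Require Import all_boot all_order all_algebra.
Set Implicit Arguments. Unset Strict Implicit. Unset Printing Implicit Defensive.
Import Order.TTheory GRing.Theory Num.Theory.

(* Items are the vertices 'I_m of a graph given by an edge relation e; *)
(* players are 'I_n (standing for {1,...,n}); u i v : rat is the       *)
(* utility of player i for item v.                                     *)

Definition simple_graph (m : nat) (e : rel 'I_m) : Prop :=
  (forall x y, e x y = e y x) /\ (forall x, e x x = false).

Definition is_star (m : nat) (e : rel 'I_m) : Prop :=
  exists c : 'I_m, forall x y : 'I_m,
    e x y = ((x == c) && (y != c)) || ((y == c) && (x != c)).

Definition utilities (n m : nat) (u : 'I_n -> 'I_m -> rat) : Prop :=
  (forall i v, 0 <= u i v)%R /\ (forall i, (\sum_(v < m) u i v)%R = 1%R).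

Definition induces_connected (m : nat) (e : rel 'I_m) (X : {set 'I_m}) : Prop :=
  forall x y, x \in X -> y \in X ->
    connect [rel a b | [&& e a b, a \in X & b \in X]] x y.

Definition valid_allocation (n m : nat) (e : rel 'I_m)
    (pi : 'I_n -> {set 'I_m}) : Prop :=
  (forall i, induces_connected e (pi i)) /\
  (forall i j, i != j -> [disjoint pi i & pi j]).

Definition proportional (n m : nat) (u : 'I_n -> 'I_m -> rat)
    (pi : 'I_n -> {set 'I_m}) : Prop :=
  forall i, ((n%:R)^-1 <= \sum_(v in pi i) u i v)%R.

Definition has_prop_allocation (n m : nat) (e : rel 'I_m)
    (u : 'I_n -> 'I_m -> rat) : Prop :=
  exists pi : 'I_n -> {set 'I_m}, valid_allocation e pi /\ proportional u pi.

(* Machine model: unit-cost RAM with addition, truncated subtraction, *)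
(* indirect addressing and conditional jumps (no multiplication);     *)
(* polynomially equivalent to Turing machines.                         *)

Inductive instr :=
  | Halt
  | Const (r k : nat)
  | Add (r a b : nat)
  | Sub (r a b : nat)
  | LoadI (r a : nat)
  | StoreI (a b : nat)
  | Jz (r l : nat)
  | Jmp (l : nat).

Definition program := seq instr.

Record state := St { pc : nat; mem : nat -> nat }.

Definition upd (M : nat -> nat) (a v : nat) : nat -> nat :=
  fun x => if x == a then v else M x.

(* one step; None when the current instruction is Halt (or pc is out
   of the program) *)
Definition step (P : program) (s : state) : option state :=
  let M := mem s in let p := pc s in
  match nth Halt P p with
  | Halt => None
  | Const r k => Some (St p.+1 (upd M r k))
  | Add r a b => Some (St p.+1 (upd M r (M a + M b)))
  | Sub r a b => Some (St p.+1 (upd M r (M a - M b)))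
  | LoadI r a => Some (St p.+1 (upd M r (M (M a))))
  | StoreI a b => Some (St p.+1 (upd M (M a) (M b)))
  | Jz r l => Some (St (if M r == 0 then l else p.+1) M)
  | Jmp l => Some (St l M)
  end.

Fixpoint run (P : program) (f : nat) (s : state) : option (nat -> nat) :=
  match step P s with
  | None => Some (mem s)
  | Some s' => match f with 0 => None | f'.+1 => run P f' s' end
  end.

Definition init (w : seq nat) : state :=
  St 0 (fun x => if x == 0 then size w else nth 0 w x.-1).

Definition bitlen (x : nat) : nat := (trunc_log 2 x).+1.
Definition insize (w : seq nat) : nat := \sum_(x <- w) bitlen x.

Definition decides_within (P : program) (w : seq nat) (t : nat) (Q : Prop) : Prop :=
  exists M, run P t (init w) = Some M /\ (M 0 = 1 <-> Q).

(* standard encoding of a CFD instance: n, m, the adjacency matrix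
   (row-major, m*m bits), then for every player i and item v the
   numerator and denominator of u i v in lowest terms *)
Definition encode (n m : nat) (e : rel 'I_m) (u : 'I_n -> 'I_m -> rat) : seq nat :=
  [:: n; m]
  ++ [seq nat_of_bool (e x y) | x <- enum 'I_m, y <- enum 'I_m]
  ++ flatten [seq [:: absz (numq (u i v)); absz (denq (u i v))]
             | i <- enum 'I_n, v <- enum 'I_m].

(* Main.v *)
Require Import Defs.
From mathcomp Require Import all_boot all_order all_algebra zify lra.
Set Implicit Arguments. Unset Strict Implicit. Unset Printing Implicit Defensive.

(* On a star every connected bundle avoiding the centre is a single leaf, so a
   proportional allocation exists iff, for some player i who takes the centre and
   all unassigned leaves, the other players can be matched to distinct leaves
   worth at least 1/n to them, the matched set having value at most 1 - 1/n
   for i.  The matchable sets of leaves form a transversal matroid, hence a set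
   of least value is found greedily by increasing u_i.  Matchability is decided
   by an auction: an unmatched leaf bids for its cheapest eligible player, raises
   that price by one and evicts the leaf held so far; a leaf all of whose players
   cost more than n exposes a violation of Hall's condition.  Utilities are made
   integral with the product of all denominators.

   The algorithm is written in a language whose loops all run exactly N times,
   where N is at least the number of input words and 2^N exceeds each of them. *)

(** * A loop language compiled to the RAM *)

(** The input lies in the very cells that must serve as registers, so a prelude first moves it
    upward; in the same pass it measures bit lengths to obtain N, which is at most twice the input
    size. A polynomial in N is therefore polynomial in the input.

    Running every loop N times makes the cost a matter of syntax; correctness must then show that N
    rounds are enough. This favours the auction: each bid raises the sum of the prices by one, and
    this sum stays below n*n, so two nested loops suffice. Player i is eligible for nothing and
    keeps price 0; hence the n prices leave one of the levels 1..n empty, and the gap yields the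
    Hall violation.

    Greedy optimality avoids matroid theory. A rejected leaf b is recorded by a tight set of
    selected leaves, none heavier than b, whose players leave no room for b. Such a certificate
    survives all later selections, and certificates bound any rival selection weight class by weight
    class.

    Without multiplication, products with denominators are formed by shift and add; N rounds suffice
    because each denominator is below 2^N. *)

Fixpoint nsteps (P : program) (k : nat) (s : state) : option state :=
  if k is k'.+1 then obind (nsteps P k') (step P s) else Some s.

(** An upper bound on the step count lets branches of different lengths share one cost. *)
Definition reach (P : program) (k : nat) (s s' : state) : Prop :=
  exists2 k', k' <= k & nsteps P k' s = Some s'.

Lemma nsteps_add P k1 k2 s :
  nsteps P (k1 + k2) s = obind (nsteps P k2) (nsteps P k1 s).
Proof. by elim: k1 s => //= k1 IH s; case: (step P s). Qed.

Lemma reach_refl P k s : reach P k s s.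
Proof. by exists 0. Qed.

Lemma reach_trans P k1 k2 s1 s2 s3 :
  reach P k1 s1 s2 -> reach P k2 s2 s3 -> reach P (k1 + k2) s1 s3.
Proof.
move=> [a ha Ha] [b hb Hb]; exists (a + b); first lia.
by rewrite nsteps_add Ha.
Qed.

Lemma reach_le P k1 k2 s s' : k1 <= k2 -> reach P k1 s s' -> reach P k2 s s'.
Proof. by move=> h [a ha Ha]; exists a => //; apply: leq_trans h. Qed.

Lemma reach_step P s s' : step P s = Some s' -> reach P 1 s s'.
Proof. by move=> H; exists 1 => //=; rewrite H. Qed.

(** [run] looks for a halting state before it looks at the fuel, so k steps need only fuel k, and
    unspent fuel is harmless. *)
Lemma run_reach P k s s' :
  reach P k s s' -> step P s' = None -> run P k s = Some (Defs.mem s').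
Proof.
move=> [a + Ha] Hh; elim: a k s Ha => [|a IH] k s /=.
  by move=> [->] _; case: k => [|k] /=; rewrite Hh.
case E: (step P s) => [s1|] //= Ha; case: k => // k hk /=.
by rewrite E; apply: IH.
Qed.

Definition code_at (P : program) (p : nat) (l : seq instr) : Prop :=
  forall i, i < size l -> nth Halt P (p + i) = nth Halt l i.

Lemma code_at_catl P p l1 l2 : code_at P p (l1 ++ l2) -> code_at P p l1.
Proof.
move=> H i hi; have:= H i; rewrite size_cat nth_cat hi; apply; lia.
Qed.

Lemma code_at_catr P p l1 l2 :
  code_at P p (l1 ++ l2) -> code_at P (p + size l1) l2.
Proof.
move=> H i hi; have:= H (size l1 + i); rewrite size_cat nth_cat addnA.
by rewrite (_ : _ + i < size l1 = false) ?addKn; [apply; lia|lia].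
Qed.

Lemma code_at_cons P p i l :
  code_at P p (i :: l) -> nth Halt P p = i /\ code_at P p.+1 l.
Proof.
move=> H; split; first by rewrite -[p]addn0 H.
by move=> j hj; rewrite addSnnS H.
Qed.

Definition exec1 (M : nat -> nat) (i : instr) : nat -> nat :=
  match i with
  | Const r k => upd M r k
  | Add r a b => upd M r (M a + M b)
  | Defs.Sub r a b => upd M r (M a - M b)
  | LoadI r a => upd M r (M (M a))
  | StoreI a b => upd M (M a) (M b)
  | Halt | Jz _ _ | Jmp _ => M
  end.

Definition straight (i : instr) : bool :=
  match i with Halt | Jz _ _ | Jmp _ => false | _ => true end.

Lemma reach_straight P p l M : code_at P p l -> all straight l ->
  reach P (size l) (St p M) (St (p + size l) (foldl exec1 M l)).
Proof.
elim: l p M => [|i l IH] p M; first by rewrite addn0 => *; apply: reach_refl.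
move=> /code_at_cons [hi Hc] /= /andP [si sl]; rewrite -addSnnS -[(size l).+1]add1n.
apply: reach_trans (IH _ _ Hc sl); apply: reach_step; rewrite /step /= hi.
by case: i si {hi}.
Qed.

(* Addresses below low serve as registers. *)
Definition low := 24.

(* Every name denotes an infinite array; scalars live in cell 0. *)
Inductive var :=
  | vW | vN | vn | vm | vT | vT1 | vmm | vpw | vx | vy | vptr | vbad | vctr
  | vt | vq | vk | vacc | vr | vrem | vU | vE | vi | vim | vs | vbest | vbw
  | vsel | vdone | vcnt | vwt | vj | vjm | vown | vprice | vcur | vbp | vbj
  | vtmp | vfail | vans.

Definition vidx (v : var) : nat :=
  match v with
  | vW => 0 | vN => 1 | vn => 2 | vm => 3 | vT => 4 | vT1 => 5 | vmm => 6
  | vpw => 7 | vx => 8 | vy => 9 | vptr => 10 | vbad => 11 | vctr => 12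
  | vt => 13 | vq => 14 | vk => 15 | vacc => 16 | vr => 17 | vrem => 18
  | vU => 19 | vE => 20 | vi => 21 | vim => 22 | vs => 23 | vbest => 24
  | vbw => 25 | vsel => 26 | vdone => 27 | vcnt => 28 | vwt => 29 | vj => 30
  | vjm => 31 | vown => 32 | vprice => 33 | vcur => 34 | vbp => 35
  | vbj => 36 | vtmp => 37 | vfail => 38 | vans => 39
  end.

(** 64 is the stride between consecutive cells of one array, so the arrays interleave without
    collision; being 2^6, it is produced by the six doublings in [addr_code]. *)
Lemma vidx_lt v : vidx v < 64.
Proof. by case: v. Qed.

Definition store := var -> nat -> nat.

Definition put (s : store) (v : var) (j x : nat) : store :=
  fun w => if vidx w == vidx v then upd (s w) j x else s w.

Inductive expr :=
  | EC (k : nat)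
  | EG (v : var) (e : expr)
  | EA (e1 e2 : expr)
  | ES (e1 e2 : expr).

Inductive cmd :=
  | Skip
  | Put (v : var) (e1 e2 : expr)
  | Seq (c1 c2 : cmd)
  | If (e : expr) (c1 c2 : cmd)
  | Loop (c : cmd).

Fixpoint eeval (e : expr) (s : store) : nat :=
  match e with
  | EC k => k
  | EG v e => s v (eeval e s)
  | EA e1 e2 => eeval e1 s + eeval e2 s
  | ES e1 e2 => eeval e1 s - eeval e2 s
  end.

(* [Loop] runs its body exactly N times, with N fixed for the whole run, so the
   cost is bounded by a polynomial in N that depends on the syntax only. *)
Fixpoint eval (N : nat) (c : cmd) (s : store) : store :=
  match c with
  | Skip => s
  | Put v e1 e2 => put s v (eeval e1 s) (eeval e2 s)
  | Seq c1 c2 => eval N c2 (eval N c1 s)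
  | If e c1 c2 => if eeval e s == 0 then eval N c2 s else eval N c1 s
  | Loop c => iter N (eval N c) s
  end.

(* Cell j of array v sits at address base + 64 * j + vidx v, with base in
   register 1; register t holds j on entry and the address on exit. *)
Definition addr_code (v : var) (t : nat) : seq instr :=
  nseq 6 (Add t t t) ++ [:: Add t t 1; Const t.+1 (vidx v); Add t t t.+1].

Fixpoint ecode (e : expr) (t : nat) : seq instr :=
  match e with
  | EC k => [:: Const t k]
  | EG v e => ecode e t ++ addr_code v t ++ [:: LoadI t t]
  | EA e1 e2 => ecode e1 t ++ ecode e2 t.+1 ++ [:: Add t t t.+1]
  | ES e1 e2 => ecode e1 t ++ ecode e2 t.+1 ++ [:: Defs.Sub t t t.+1]
  end.

Fixpoint esize (e : expr) : nat :=
  match e with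
  | EC _ => 1
  | EG _ e => esize e + 10
  | EA e1 e2 | ES e1 e2 => esize e1 + (esize e2 + 1)
  end.

Fixpoint eregs (e : expr) : nat :=
  match e with
  | EC _ => 1
  | EG _ e => maxn (eregs e) 2
  | EA e1 e2 | ES e1 e2 => maxn (eregs e1) (eregs e2).+1
  end.

(** Jump targets are absolute and must be known before the code that they skip is generated, so code
    length is computed from the syntax. *)
Fixpoint csize (c : cmd) : nat :=
  match c with
  | Skip => 0
  | Put _ e1 e2 => esize e1 + (9 + (esize e2 + 1))
  | Seq c1 c2 => csize c1 + csize c2
  | If e c1 c2 => esize e + (1 + (csize c1 + (1 + csize c2)))
  | Loop c => 3 + (csize c + 3)
  end.

Fixpoint ccode (c : cmd) (t p : nat) : seq instr :=
  match c with
  | Skip => [::]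
  | Put v e1 e2 => ecode e1 t ++ addr_code v t ++ ecode e2 t.+1
                   ++ [:: StoreI t t.+1]
  | Seq c1 c2 => ccode c1 t p ++ ccode c2 t (p + csize c1)
  | If e c1 c2 =>
      let p1 := p + esize e + 1 in let p2 := p1 + csize c1 + 1 in
      ecode e t ++ [:: Jz t p2] ++ ccode c1 t p1
      ++ [:: Jmp (p2 + csize c2)] ++ ccode c2 t p2
  | Loop c =>
      [:: Const t 0; Add t t 2; Jz t (p + 3 + csize c + 3)]
      ++ ccode c t.+1 (p + 3) ++ [:: Const t.+1 1; Defs.Sub t t t.+1; Jmp (p + 2)]
  end.

Fixpoint cregs (c : cmd) : nat :=
  match c with
  | Skip => 0
  | Put _ e1 e2 => maxn (eregs e1) (maxn 2 (eregs e2).+1)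
  | Seq c1 c2 => maxn (cregs c1) (cregs c2)
  | If e c1 c2 => maxn (eregs e) (maxn (cregs c1) (cregs c2))
  | Loop c => (maxn 1 (cregs c)).+1
  end.

(** Both branches of [If] are charged, which keeps the bound independent of the store. The 4 per
    round pays for the test, the constant 1, the decrement and the jump back. *)
Fixpoint cost (N : nat) (c : cmd) : nat :=
  match c with
  | Skip => 0
  | Put _ e1 e2 => csize c
  | Seq c1 c2 => cost N c1 + cost N c2
  | If e c1 c2 => esize e + (1 + (cost N c1 + (1 + cost N c2)))
  | Loop c => 3 + N * (cost N c + 4)
  end.

Lemma size_ecode e t : size (ecode e t) = esize e.
Proof.
elim: e t => [k|v e IH|e1 IH1 e2 IH2|e1 IH1 e2 IH2] t //=.
- by rewrite !size_cat IH.
- by rewrite !size_cat IH1 IH2.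
- by rewrite !size_cat IH1 IH2.
Qed.

Lemma size_ccode c t p : size (ccode c t p) = csize c.
Proof.
elim: c t p => [|v e1 e2|c1 IH1 c2 IH2|e c1 IH1 c2 IH2|c IH] t p //=.
- by rewrite size_cat size_ecode; congr addn; rewrite /addr_code /= size_cat size_ecode.
- by rewrite size_cat IH1 IH2.
- by rewrite size_cat size_ecode /= size_cat IH1 /= IH2.
- by rewrite size_cat IH.
Qed.

Lemma exec_doubles k t M r :
  foldl exec1 M (nseq k (Add t t t)) r = if r == t then 2 ^ k * M t else M r.
Proof.
elim: k M => [|k IH] M /=; first by case: eqP => // ->; rewrite mul1n.
rewrite IH /upd eqxx; case: eqP => // _; rewrite expnS; lia.
Qed.

(** * Simulation of the loop language by the compiled code *)

Section Correctness.
Variables (P : program) (base N : nat).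
Hypothesis low_base : low <= base.

Definition rep (M : nat -> nat) (s : store) : Prop :=
  [/\ M 1 = base, M 2 = N &
      forall v j, M (base + 64 * j + vidx v) = s v j].

(** The footprint of an expression: it may use registers from t on as scratch but never touches the
    memory from [low] up, so [rep] survives. *)
Definition agree_off (t : nat) (M M' : nat -> nat) : Prop :=
  forall r, (r < t) || (low <= r) -> M' r = M r.

Lemma agree_off_trans t1 t2 M1 M2 M3 : t1 <= t2 ->
  agree_off t1 M1 M2 -> agree_off t2 M2 M3 -> agree_off t1 M1 M3.
Proof. by move=> h H1 H2 r hr; rewrite H2 ?H1 //; lia. Qed.

Lemma agree_off_upd t M r x : t <= r < low -> agree_off t M (upd M r x).
Proof. by move=> h r' hr'; rewrite /upd; case: eqP => //; lia. Qed.

Lemma rep_agree t M M' s : 2 < t -> agree_off t M M' -> rep M s -> rep M' s.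
Proof.
move=> ht H [h1 h2 h3]; split; rewrite ?H ?h1 ?h2 //; try lia.
by move=> v j; rewrite H ?h3 //; have := low_base; lia.
Qed.

Lemma addr_ok v t p M : code_at P p (addr_code v t) -> 2 < t -> t.+1 < low ->
  M 1 = base ->
  exists M', [/\ reach P 9 (St p M) (St (p + 9) M'),
    M' t = base + 64 * M t + vidx v & agree_off t M M'].
Proof.
move=> Hc ht hl hb; have [t1 tS St] :
  [/\ (1 == t) = false, (t.+1 == t) = false & (t == t.+1) = false] by split; lia.
exists (foldl exec1 M (addr_code v t)); split.
- exact: (reach_straight _ Hc isT).
- rewrite foldl_cat; set M1 := foldl _ M _; rewrite /= /upd !eqxx ?tS ?t1 St.
  by rewrite /M1 !exec_doubles eqxx t1 hb; lia.
move=> r hr.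
have [rt rt1] : (r == t) = false /\ (r == t.+1) = false by split; lia.
rewrite foldl_cat; move: (exec_doubles 6 t M r); rewrite rt.
by move: (foldl exec1 M (nseq 6 _)) => M1 E /=; rewrite /upd rt rt1.
Qed.

Lemma ecode_ok e t p M s : code_at P p (ecode e t) -> rep M s -> 2 < t ->
  t + eregs e <= low ->
  exists M', [/\ reach P (esize e) (St p M) (St (p + esize e) M'),
    M' t = eeval e s & agree_off t M M'].
Proof.
elim: e t p M => [k|v e IH|e1 IH1 e2 IH2|e1 IH1 e2 IH2] t p M Hc HR ht /= hr.
- exists (upd M t k); split; last by apply: agree_off_upd; lia.
    exact: (reach_straight _ Hc isT).
  by rewrite /upd eqxx.
- have Hc1 := code_at_catl Hc; have := code_at_catr Hc; rewrite size_ecode => Hc2.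
  have [|M1 [R1 V1 A1]] := IH t p M Hc1 HR ht; first lia.
  have HR1 := rep_agree ht A1 HR; have [hb _ hs] := HR1.
  have [|M2 [R2 V2 A2]] := addr_ok (code_at_catl Hc2) ht _ hb; first lia.
  have HR2 := rep_agree ht A2 HR1; have [_ _ hs2] := HR2.
  have /= Hc3 := code_at_catr Hc2; have R3 := reach_straight M2 Hc3 isT.
  exists (upd M2 t (M2 (M2 t))); split.
  + rewrite (_ : esize e + 10 = esize e + (9 + 1)) //.
    apply: (reach_trans R1); apply: (reach_trans R2).
    by rewrite !addnA; apply: R3.
  + by rewrite /upd eqxx V2 V1 hs2.
  + apply: agree_off_trans (leqnn t) A1 _; apply: agree_off_trans (leqnn t) A2 _.
    by apply: agree_off_upd; lia.
- have Hc1 := code_at_catl Hc; have := code_at_catr Hc; rewrite size_ecode => Hc2.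
  have [|M1 [R1 V1 A1]] := IH1 t p M Hc1 HR ht; first lia.
  have HR1 := rep_agree ht A1 HR.
  have [||M2 [R2 V2 A2]] := IH2 _ _ _ (code_at_catl Hc2) HR1; try lia.
  have := code_at_catr Hc2; rewrite size_ecode => Hc3.
  have R3 := reach_straight M2 Hc3 isT.
  exists (upd M2 t (M2 t + M2 t.+1)); split.
  + apply: (reach_trans R1); apply: (reach_trans R2).
    by rewrite !addnA; apply: R3.
  + by rewrite /upd eqxx V2 A2 ?V1 //; lia.
  + apply: agree_off_trans (leqnn t) A1 _.
    apply: (@agree_off_trans _ t _ M2) => //; last by apply: agree_off_upd; lia.
    by move=> r hr'; apply: A2; lia.
- have Hc1 := code_at_catl Hc; have := code_at_catr Hc; rewrite size_ecode => Hc2.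
  have [|M1 [R1 V1 A1]] := IH1 t p M Hc1 HR ht; first lia.
  have HR1 := rep_agree ht A1 HR.
  have [||M2 [R2 V2 A2]] := IH2 _ _ _ (code_at_catl Hc2) HR1; try lia.
  have := code_at_catr Hc2; rewrite size_ecode => Hc3.
  have R3 := reach_straight M2 Hc3 isT.
  exists (upd M2 t (M2 t - M2 t.+1)); split.
  + apply: (reach_trans R1); apply: (reach_trans R2).
    by rewrite !addnA; apply: R3.
  + by rewrite /upd eqxx V2 A2 ?V1 //; lia.
  + apply: agree_off_trans (leqnn t) A1 _.
    apply: (@agree_off_trans _ t _ M2) => //; last by apply: agree_off_upd; lia.
    by move=> r hr'; apply: A2; lia.
Qed.

(** Commands do write memory, so only the registers below t are claimed here; registers 1 and 2 are
    left to [rep], which is re-established separately. *)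
Definition agree_low (t : nat) (M M' : nat -> nat) : Prop :=
  forall r, 2 < r < t -> M' r = M r.

Lemma agree_off_low t M M' : agree_off t M M' -> agree_low t M M'.
Proof. by move=> H r hr; apply: H; lia. Qed.

Lemma agree_low_trans t t' M1 M2 M3 : t <= t' ->
  agree_low t M1 M2 -> agree_low t' M2 M3 -> agree_low t M1 M3.
Proof. by move=> h H1 H2 r hr; rewrite H2 ?H1 //; lia. Qed.

Lemma rep_put M s v j x : rep M s ->
  rep (upd M (base + 64 * j + vidx v) x) (put s v j x).
Proof.
move=> [h1 h2 h3]; have := low_base; rewrite /low => hl; split.
- by rewrite /upd ifN //; lia.
- by rewrite /upd ifN //; lia.
move=> w k; rewrite /upd /put h3.
have := vidx_lt v; have := vidx_lt w => hw hv.
case: (vidx w =P vidx v) => [->|ne]; last by rewrite ifN //; lia.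
rewrite /upd; case: (k =P j) => [->|ne]; first by rewrite eqxx.
by rewrite ifN //; lia.
Qed.

(** A loop keeps its counter in register t and has its body compiled at [t.+1]; [agree_low t.+1] for
    the body is what protects the counter, also under nesting. *)
Lemma ccode_ok c t p M s : code_at P p (ccode c t p) -> rep M s -> 2 < t ->
  t + cregs c <= low ->
  exists M', [/\ reach P (cost N c) (St p M) (St (p + csize c) M'),
    rep M' (eval N c s) & agree_low t M M'].
Proof.
elim: c t p M s => [|v e1 e2|c1 IH1 c2 IH2|e c1 IH1 c2 IH2|c IH] t p M s
  Hc HR ht /= hr.
- by exists M; split=> //; rewrite addn0; apply: reach_refl.
- have Hc1 := code_at_catl Hc; have := code_at_catr Hc; rewrite size_ecode => Hc2.
  have [|M1 [R1 V1 A1]] := ecode_ok Hc1 HR ht; first lia.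
  have HR1 := rep_agree ht A1 HR; have [hb _ _] := HR1.
  have [|M2 [R2 V2 A2]] := addr_ok (code_at_catl Hc2) ht _ hb; first lia.
  have HR2 := rep_agree ht A2 HR1.
  have /= Hc3 := code_at_catr Hc2.
  have [||M3 [R3 V3 A3]] := ecode_ok (code_at_catl Hc3) HR2; try lia.
  have ht1 : 2 < t.+1 by lia.
  have HR3 := rep_agree ht1 A3 HR2.
  have := code_at_catr Hc3; rewrite size_ecode => Hc4.
  have R4 := reach_straight M3 Hc4 isT.
  exists (upd M3 (M3 t) (M3 t.+1)); split.
  + apply: (reach_trans R1); apply: (reach_trans R2); apply: (reach_trans R3).
    by rewrite !addnA; apply: R4.
  + by rewrite V3 A3 ?V2 ?V1; [apply: rep_put|lia].
  + apply: agree_low_trans (leqnn t) (agree_off_low A1) _.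
    apply: agree_low_trans (leqnn t) (agree_off_low A2) _.
    apply: agree_low_trans (leqnSn t) (_ : agree_low t M2 M3) _.
      by move=> r hr'; apply: A3; lia.
    move=> r hr'; rewrite /upd ifN // A3 ?V2; last lia.
    by have := low_base; lia.
- have [|M1 [R1 HR1 A1]] := IH1 t p M s (code_at_catl Hc) HR ht; first lia.
  have := code_at_catr Hc; rewrite size_ccode => Hc2.
  have [|M2 [R2 HR2 A2]] := IH2 t _ M1 _ Hc2 HR1 ht; first lia.
  exists M2; split=> //; last exact: agree_low_trans A1 A2.
  by apply: (reach_trans R1); rewrite addnA.
- have Hc1 := code_at_catl Hc; have := code_at_catr Hc; rewrite size_ecode => Hc2.
  have [|M1 [R1 V1 A1]] := ecode_ok Hc1 HR ht; first lia.
  have HR1 := rep_agree ht A1 HR.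
  have [hj Hc3] := code_at_cons Hc2; rewrite -addn1 in Hc3.
  have Hc4 := code_at_catl Hc3; have := code_at_catr Hc3.
  rewrite size_ccode => /code_at_cons [hj2 Hc5]; rewrite -addn1 in Hc5.
  have Rj : reach P 1 (St (p + esize e) M1)
    (St (if eeval e s == 0 then p + esize e + 1 + csize c1 + 1
         else p + esize e + 1) M1).
    by apply: reach_step; rewrite /step /= hj V1 [p + esize e + 1]addn1.
  case: ifP Rj => h Rj.
    have [|M2 [R2 HR2 A2]] := IH2 t _ M1 _ Hc5 HR1 ht; first lia.
    exists M2; split=> //; last first.
      exact: agree_low_trans (leqnn t) (agree_off_low A1) A2.
    apply: reach_trans R1 _; apply: reach_trans Rj _.
    have -> : p + (esize e + (1 + (csize c1 + (1 + csize c2)))) =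
        p + esize e + 1 + csize c1 + 1 + csize c2 by lia.
    by apply: reach_le R2; lia.
  have [|M2 [R2 HR2 A2]] := IH1 t _ M1 _ Hc4 HR1 ht; first lia.
  exists M2; split=> //; last first.
    exact: agree_low_trans (leqnn t) (agree_off_low A1) A2.
  apply: reach_trans R1 _; apply: reach_trans Rj _; apply: reach_trans R2 _.
  apply: (@reach_le _ 1); first lia.
  by apply: reach_step; rewrite /step /= hj2; congr (Some (St _ _)); lia.
- have ht1 : 2 < t.+1 by lia.
  have [h0 Hc1] := code_at_cons Hc; have [h1 Hc2] := code_at_cons Hc1.
  have [h2 Hc3] := code_at_cons Hc2.
  have Hb := code_at_catl Hc3; have := code_at_catr Hc3; rewrite size_ccode => Hc4.
  have [h3 Hc5] := code_at_cons Hc4; have [h4 Hc6] := code_at_cons Hc5.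
  have [h5 _] := code_at_cons Hc6.
  pose M1 := upd (upd M t 0) t N.
  have A1 : agree_off t M M1.
    apply: (@agree_off_trans _ t _ (upd M t 0)) => //; apply: agree_off_upd; lia.
  have R1 : reach P 2 (St p M) (St p.+2 M1).
    have E : upd M t 0 t + upd M t 0 2 = N.
      by rewrite /upd eqxx ifN ?add0n; [have [_ ->] := HR|lia].
    by exists 2 => //=; rewrite /step /= h0 /= h1 /= E.
  have HR1 := rep_agree ht A1 HR.
  (* The induction is on the counter value and starts at the test instruction, the point to which
     each round returns. *)
  have main : forall k M1 s, M1 t = k -> rep M1 s -> exists M',
    [/\ reach P (1 + k * (cost N c + 4)) (St p.+2 M1) (St (p + csize (Loop c)) M'),
        rep M' (iter k (eval N c) s) & agree_low t M1 M'].
    elim=> [|k IHk] {A1 R1 HR1 HR} M1 {}s hk HR.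
      exists M1; split=> //; apply: (@reach_le _ 1); first lia.
      by apply: reach_step; rewrite /step /= h2 hk /=; congr (Some (St _ _)); lia.
    rewrite (_ : p.+3 = p + 3) in Hb; last lia.
    have [|M2 [R2 HR2 A2]] := IH t.+1 _ M1 _ Hb HR ht1; first lia.
    pose M3 := upd (upd M2 t.+1 1) t k.
    have A3 : agree_off t M2 M3.
      apply: (@agree_off_trans _ t _ (upd M2 t.+1 1)) => //; apply: agree_off_upd; lia.
    have [|M4 [R4 HR4 A4]] := IHk M3 _ _ (rep_agree ht A3 HR2).
      by rewrite /M3 /upd eqxx.
    exists M4; rewrite iterSr; split=> //.
      have Rj : reach P 1 (St p.+2 M1) (St (p + 3) M1).
        by apply: reach_step; rewrite /step /= h2 hk /=; congr (Some (St _ _)); lia.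
      have Re : reach P 3 (St (p + 3 + csize c) M2) (St p.+2 M3).
        exists 3 => //=; rewrite (_ : p + 3 = p.+3); last lia.
        rewrite /step /= h3 /= h4 /= h5 /=; congr (Some (St _ _)); first lia.
        rewrite /M3 /upd eqxx [t == _]ltn_eqF // A2; last lia.
        by rewrite hk subn1.
      apply: (@reach_le _ (1 + (cost N c + (3 + (1 + k * (cost N c + 4)))))); first lia.
      by apply: reach_trans Rj _; apply: reach_trans R2 _; apply: reach_trans Re _.
    apply: agree_low_trans (leqnn t) _ A4.
    apply: agree_low_trans (leqnn t) (_ : agree_low t M1 M2) (agree_off_low A3).
    by move=> r hr'; apply: A2; lia.
  have [|M2 [R2 HR2 A2]] := main N M1 s _ HR1; first by rewrite /M1 /upd eqxx.
  exists M2; split=> //; last first.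
    exact: agree_low_trans (leqnn t) (agree_off_low A1) A2.
  by apply: reach_le (reach_trans R1 R2); lia.
Qed.

End Correctness.

(** * Frame property and polynomial cost of commands *)

Fixpoint writes (c : cmd) (v : var) : bool :=
  match c with
  | Skip => false
  | Put w _ _ => vidx v == vidx w
  | Seq c1 c2 | If _ c1 c2 => writes c1 v || writes c2 v
  | Loop c => writes c v
  end.

Lemma eval_frame N c s v : ~~ writes c v -> eval N c s v = s v.
Proof.
elim: c s => [|w e1 e2|c1 IH1 c2 IH2|e c1 IH1 c2 IH2|c IH] s //=.
- by rewrite /put => /negPf ->.
- by rewrite negb_or => /andP [h1 h2]; rewrite IH2 // IH1.
- by rewrite negb_or => /andP [h1 h2]; case: ifP => _; rewrite ?IH2 ?IH1.
- by move=> h; elim: {1}N => //= k IHk; rewrite IH.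
Qed.

(** Each [Loop] raises the exponent by one. Exponents of composed commands are added, which is crude
    but harmless since the command is fixed. *)
Lemma cost_poly c : exists C k, forall N, cost N c <= C * N.+1 ^ k.
Proof.
elim: c => [|w e1 e2|c1 [C1 [k1 IH1]] c2 [C2 [k2 IH2]]
  |e c1 [C1 [k1 IH1]] c2 [C2 [k2 IH2]]|c [C [k IH]]] /=.
- by exists 0, 0.
- by eexists; exists 0 => N; rewrite expn0 muln1; apply: leqnn.
- exists (C1 + C2), (k1 + k2) => N.
  have := IH1 N; have := IH2 N; rewrite mulnDl expnD.
  have : 0 < N.+1 ^ k1 by rewrite expn_gt0.
  have : 0 < N.+1 ^ k2 by rewrite expn_gt0.
  by nia.
- exists (C1 + C2 + esize e + 2), (k1 + k2) => N.
  have := IH1 N; have := IH2 N; rewrite expnD.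
  have : 0 < N.+1 ^ k1 by rewrite expn_gt0.
  have : 0 < N.+1 ^ k2 by rewrite expn_gt0.
  by nia.
- exists (C + 7), k.+1 => N; have := IH N; rewrite expnS.
  have : 0 < N.+1 ^ k by rewrite expn_gt0.
  by nia.
Qed.

(** * Relocating the input *)

Lemma code_at_sub P p l a b : code_at P p l ->
  code_at P (p + a) (take b (drop a l)).
Proof.
move=> H i; rewrite size_take_min size_drop => hi.
rewrite nth_take ?nth_drop -?addnA ?H //; lia.
Qed.

(** Register 0 is first moved [low] cells past the input, so the saved copies land above both the
    input and the registers, even when the input is shorter than [low]. *)
Definition save_code : seq instr :=
  [:: Const 3 low; Add 0 0 3; Const 3 1]
  ++ flatten [seq [:: Add 0 0 3; StoreI 0 j] | j <- iota 1 low.-1].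

Definition setup_code : seq instr :=
  [:: Add 1 0 3; Const 4 (low + low.-1); Defs.Sub 0 0 4; Const 2 0; Const 8 low].

(** 49 instructions of [save_code] and 5 of [setup_code] come before. *)
Definition copy_start := 54.

(* Copies input cell j (register 0, counting down) to cell j of vW, reading cells
   below low from their saved copies; the inner loop doubles register 6 past the
   word just read and increments the bound N (register 2) at each doubling. *)
Definition copy_code : seq instr :=
  [:: Jz 0 (copy_start + 29);
      Defs.Sub 7 8 0;
      Jz 7 (copy_start + 6);
      Defs.Sub 5 1 8;
      Add 5 5 0;
      Jmp (copy_start + 8);
      Const 5 0;
      Add 5 5 0;
      LoadI 5 5;
      Const 4 0;
      Add 4 4 0;
      Add 4 4 4; Add 4 4 4; Add 4 4 4; Add 4 4 4; Add 4 4 4; Add 4 4 4;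
      Add 4 4 1;
      StoreI 4 5;
      Add 2 2 3;
      Const 6 1;
      Defs.Sub 7 6 5;
      Jz 7 (copy_start + 24);
      Jmp (copy_start + 27);
      Add 6 6 6;
      Add 2 2 3;
      Jmp (copy_start + 21);
      Defs.Sub 0 0 3;
      Jmp copy_start].

Definition prelude : seq instr := save_code ++ setup_code ++ copy_code.

Section Prelude.
Variables (P : program) (w : seq nat).

(* Register 3 is clobbered before it can be saved, so input cell 3 is lost; it is
   the diagonal entry (0,0) of the adjacency matrix, which is never used. *)
Definition inp : nat -> nat := upd (Defs.mem (init w)) 3 1.

Let L := size w.
Let base := L + low + low.

Lemma inp_big r : L < r -> r != 3 -> inp r = 0.
Proof.
move=> h h3; rewrite /inp /upd (negPf h3) /= ifN; last lia.
by apply: nth_default; lia.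
Qed.

Lemma save_ok : code_at P 0 save_code ->
  exists M, [/\ reach P 49 (init w) (St 49 M), M 0 = L + low + low.-1,
    M 3 = 1,
    (forall j, 0 < j < low -> M (L + low + j) = inp j) &
    (forall r, 0 < r <= L + low \/ base <= r -> M r = inp r)].
Proof.
move=> Hc; pose M0 := foldl exec1 (Defs.mem (init w)) (take 3 save_code).
have R0 : reach P 3 (init w) (St 3 M0).
  exact: (reach_straight _ (@code_at_sub P 0 _ 0 3 Hc) isT).
suff main : forall k, k < low -> exists M,
    [/\ reach P (3 + k.*2) (init w) (St (3 + k.*2) M), M 0 = L + low + k,
    M 3 = 1,
    (forall j, 0 < j <= k -> M (L + low + j) = inp j) &
    (forall r, 0 < r <= L + low \/ L + low + k < r -> M r = inp r)].
  have [M [h1 h2 h3 h4 h5]] := main low.-1 isT.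
  exists M; split; [exact: h1|exact: h2|exact: h3|exact: h4|] => r hr.
  by apply: h5; move: hr; rewrite /base /low; lia.
elim=> [|k IH] hk.
  exists M0; split=> //.
  - by rewrite addn0.
  - by lia.
  - by move=> r hr; rewrite /M0 /inp /= /upd; case: r hr => [|[|[|[|]]]] //=; lia.
have [|M [R V0 V3 Vs Vr]] := IH; first lia.
have Ek : take 2 (drop (3 + k.*2) save_code) = [:: Add 0 0 3; StoreI 0 k.+1].
  by move: k hk {IH R V0 Vs Vr}; do 24?case=> //.
have Hk := @code_at_sub P 0 _ (3 + k.*2) 2 Hc; rewrite Ek add0n in Hk.
have := reach_straight M Hk isT; rewrite /= V0 V3.
set M' := upd _ _ _ => R'; exists M'.
have EM' r : M' r = if r == L + low + k.+1 then M k.+1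
    else if r == 0 then L + low + k.+1 else M r.
  by rewrite /M' /upd /= addn1 -addnS.
have HL : 0 < low by [].
split.
- by have := reach_trans R R'; rewrite -addnA doubleS !addnS addn0.
- by rewrite EM'; case: eqP => //; lia.
- by rewrite EM' V3; case: eqP => //; move: hk; rewrite /low; lia.
- move=> j hj; rewrite EM'; case: eqP => [E|ne].
    have ->: j = k.+1 by lia.
    by apply: Vr; lia.
  by rewrite ifN ?Vs //; lia.
- by move=> r hr; rewrite EM' !ifN ?Vr //; lia.
Qed.

Hypothesis copy_at : code_at P copy_start copy_code.

Lemma double_ok a x M : M 6 = 2 ^ a -> M 5 = x -> M 3 = 1 ->
  exists d M', [/\ reach P (6 * d + 3) (St (copy_start + 21) M) (St (copy_start + 27) M'),
    M' 2 = M 2 + d, x < 2 ^ (a + d), d = 0 \/ 2 ^ (a + d).-1 <= x &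
    forall r, r \notin [:: 2; 6; 7] -> M' r = M r].
Proof.
have [k hk] := ubnP (x.+1 - 2 ^ a); elim: k => // k IH in a M hk *.
move=> h6 h5 h3.
have R0 : reach P 1 (St (copy_start + 21) M) (St (copy_start + 22) (upd M 7 (2 ^ a - x))).
  by apply: reach_step; rewrite /step /= (copy_at (i := 21) isT) /= h6 h5.
case: (ltnP x (2 ^ a)) => hx.
  exists 0, (upd M 7 (2 ^ a - x)); rewrite !addn0; split=> //.
  - apply: (reach_trans (k2 := 2) R0); exists 2 => //=.
    rewrite /step /= (copy_at (i := 22) isT) /= ifN; last by rewrite /upd /=; lia.
    by rewrite (copy_at (i := 23) isT).
  - by left.
  - by move=> r; rewrite !inE /upd => /norP [_ /norP [_ /negPf ->]].
pose M1 := upd (upd (upd M 7 (2 ^ a - x)) 6 (2 ^ a + 2 ^ a)) 2 (M 2 + 1).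
have [||||d [M' [R E2 hd1 hd2 Er]]] := IH a.+1 M1.
- by have := expn_gt0 2 a; rewrite expnS; clear -hk hx; lia.
- by rewrite /M1 /upd /= expnS mul2n addnn.
- by [].
- by [].
exists d.+1, M'; split=> //.
- apply: (@reach_le _ (1 + (4 + (6 * d + 3)))); first lia.
  apply: (reach_trans R0); apply: reach_trans R; exists 4 => //=.
  rewrite /step /= (copy_at (i := 22) isT) /= ifT; last by rewrite /upd /=; lia.
  rewrite (copy_at (i := 24) isT) /= (copy_at (i := 25) isT) /=.
  by rewrite (copy_at (i := 26) isT) /= /upd /= h6 h3.
- by rewrite E2 /M1 /upd /=; lia.
- by rewrite -addSnnS.
- right; case: hd2 => [->|]; last by rewrite -addSnnS.
  by rewrite addn1.
- move=> r hr; rewrite Er //; move: hr; rewrite !inE /M1 /upd.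
  by move=> /norP [/negPf -> /norP [/negPf -> /negPf ->]].
Qed.

(** [Nc] gains one per word plus the doublings for that word, hence the lower bound by the number of
    words copied and the upper bound by twice their bit length. The zeros recorded above [base] are
    why all variables other than [vW] start at 0. *)
Definition copied (j Nc : nat) (M : nat -> nat) : Prop :=
  [/\ [/\ M 0 = j, M 1 = base, M 2 = Nc, M 3 = 1 & M 8 = low],
    (forall j, 0 < j < low -> M (L + low + j) = inp j),
    (forall r, low <= r <= L -> M r = inp r),
    (forall k v, M (base + 64 * k + vidx v) =
        if (vidx v == 0) && (j < k <= L) then inp k else 0) &
    [/\ L - j <= Nc, Nc <= \sum_(j <= k < L) (2 * bitlen (nth 0 w k)) &
       forall k, j < k <= L -> inp k < 2 ^ Nc]].

(** One word takes at most 24 instructions plus 6 per doubling; a bit length is at least 1, so 40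
    per bit is enough. *)
Lemma copy_step j Nc M : j < L -> copied j.+1 Nc M ->
  exists M' N', reach P (40 * bitlen (nth 0 w j)) (St copy_start M) (St copy_start M') /\
     copied j N' M'.
Proof.
move=> hj [[h0 h1 h2 h3 h8] Hs Hr Hc [hN1 hN2 hN3]].
have R0 : reach P 2 (St copy_start M) (St (copy_start + 2) (upd M 7 (low - j.+1))).
  exists 2 => //=; rewrite /step /= (copy_at (i := 0) isT) /= h0 /=.
  by rewrite (copy_at (i := 1) isT) /= h8 h0.
have [M1 [R1 V5 A1]] : exists M1, [/\ reach P 4 (St (copy_start + 2) (upd M 7 (low - j.+1)))
   (St (copy_start + 8) M1), M (M1 5) = inp j.+1 /\ 8 < M1 5 & forall r, r \notin [:: 5; 7] -> M1 r = M r].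
  case: (ltnP j.+1 low) => hl.
    exists (upd (upd (upd M 7 (low - j.+1)) 5 (base - low)) 5 (base - low + j.+1)); split.
    - exists 4 => //=; rewrite /step /= (copy_at (i := 2) isT) /= ifN; last by rewrite /upd /=; lia.
      rewrite (copy_at (i := 3) isT) /= (copy_at (i := 4) isT) /= (copy_at (i := 5) isT) /=.
      by rewrite /upd /= h1 h8 h0.
    - rewrite /upd /= addnK Hs //; split=> //; rewrite /low; lia.
    - by move=> r; rewrite !inE /upd => /norP [/negPf -> /negPf ->].
  exists (upd (upd (upd M 7 (low - j.+1)) 5 0) 5 (0 + j.+1)); split.
  - exists 3 => //=; rewrite /step /= (copy_at (i := 2) isT) /= ifT; last by rewrite /upd /=; lia.
    rewrite (copy_at (i := 6) isT) /= (copy_at (i := 7) isT) /=.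
    by rewrite /upd /= h0.
  - rewrite /upd /= add0n Hr //; [split=> //; move: hl; rewrite /low; lia|lia].
  - by move=> r; rewrite !inE /upd => /norP [/negPf -> /negPf ->].
have hb : 8 < base by rewrite /base /low; lia.
have V5' : M1 (M1 5) = inp j.+1.
  by have [<- h5] := V5; rewrite A1 // !inE; lia.
have Ec : take 13 (drop 8 copy_code) = [:: LoadI 5 5; Const 4 0; Add 4 4 0]
  ++ nseq 6 (Add 4 4 4) ++ [:: Add 4 4 1; StoreI 4 5; Add 2 2 3; Const 6 1] by [].
have := reach_straight M1 (@code_at_sub P _ _ 8 13 copy_at) isT.
rewrite Ec 2!foldl_cat.
set Ma := foldl exec1 M1 _; set Mb := foldl exec1 Ma _; set M2 := foldl exec1 Mb _ => R2.
have EMb r : Mb r = if r == 4 then 64 * j.+1 else if r == 5 then inp j.+1 else M1 r.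
  rewrite /Mb exec_doubles; case: (r =P 4) => [_|/eqP/negPf n4]; rewrite /Ma /= /upd /=.
    by rewrite A1 ?h0.
  by rewrite n4 V5'.
have EM2 r : M2 r = if r == base + 64 * j.+1 then inp j.+1 else
  if r == 6 then 1 else if r == 2 then Nc.+1 else if r == 5 then inp j.+1 else
  if r == 4 then base + 64 * j.+1 else if r == 7 then M1 7 else M r.
  rewrite /M2; clear R2 M2; clearbody Mb; rewrite /= /upd /= !EMb /= (A1 1) // (A1 2) // (A1 3) // h1 h2 h3.
  clear -A1 hb; rewrite [64 * _ + base]addnC.
  have ne k : k <= 8 -> (k == base + 64 * j.+1) = false by lia.
  rewrite (ne 2) // (ne 3) // /= addn1.
  case: (r =P 6) => [->|n2]; first by rewrite ne.
  case: (r =P 2) => [->|n3]; first by rewrite ne.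
  case: (r =P _) => // n1.
  case: (r =P 4) => [->|n4] //=; case: (r =P 5) => [_|n5] //=.
  by case: (r =P 7) => [->//|n6]; rewrite A1 // !inE; apply/norP; split; apply/eqP.
clearbody M2; clear Ma Mb EMb Ec.
have [|||d [M3 [R3 V2 hd1 hd2 A3]]] := @double_ok 0 (inp j.+1) M2.
- by rewrite EM2 ifN //; lia.
- by rewrite EM2 ifN //; lia.
- by rewrite EM2 ifN //=; lia.
rewrite !add0n in hd1 hd2.
have hd : d <= bitlen (nth 0 w j).
  case: (posnP d) => [->//|hd0]; case: hd2 => [->//|]; rewrite /bitlen.
  (* The overwritten cell holds 1, which causes a single doubling; any bit length covers that. *)
  rewrite /inp /upd; case: eqP => _ /= hd2.
    have : d.-1 = 0 by case: (d.-1) hd2 => // d'; rewrite expnS; have := expn_gt0 2 d'; lia.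
    lia.
  have := trunc_log_max (ltnSn 1) hd2; lia.
exists (upd M3 0 j), (Nc.+1 + d); split.
  have R4 : reach P 2 (St (copy_start + 27) M3) (St copy_start (upd M3 0 j)).
    exists 2 => //=; rewrite /step /= (copy_at (i := 27) isT) /= (copy_at (i := 28) isT) /=.
    by rewrite !A3 // !EM2 !ifN ?h0 ?h3 /= ?subn1 //; lia.
  have := reach_trans R0 (reach_trans R1 (reach_trans R2 (reach_trans R3 R4))).
  by apply: reach_le; rewrite /=; move: hd; rewrite /bitlen; lia.
have Em r : 8 < r -> upd M3 0 j r = if r == base + 64 * j.+1 then inp j.+1 else M r.
  move=> hr; rewrite /upd ifN ?A3 ?inE ?EM2; try lia.
  by case: eqP => // _; rewrite !ifN //; lia.
split.
- split; rewrite /upd //= ?V2 ?A3 // EM2 ?ifN //=; try lia.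
- by move=> k hk; rewrite Em ?ifN ?Hs //; move: hk; rewrite /base /low; lia.
- by move=> r hr; rewrite Em ?ifN ?Hr //; move: hr; rewrite /base /low; lia.
- move=> k v; rewrite Em; last by move: hb; lia.
  have hv := vidx_lt v.
  case: eqP => [E|ne].
    have [-> ->] : vidx v = 0 /\ k = j.+1 by lia.
    by rewrite /= ltnSn hj.
  rewrite Hc; case: eqP => //= E0; have nk : k != j.+1 by apply/eqP; lia.
  by rewrite [j.+1 < k]ltn_neqAle eq_sym nk.
- split; first by lia.
    by rewrite big_ltn //=; have : 0 < bitlen (nth 0 w j) by []; lia.
  move=> k hk; case: (k =P j.+1) => [->|nk].
    by apply: leq_trans hd1 _; rewrite leq_exp2l //; lia.
  apply: leq_trans (hN3 k _) _; first lia.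
  by rewrite leq_exp2l //; lia.
Qed.

Lemma copy_ok j Nc M : j <= L -> copied j Nc M ->
  exists M' N', reach P (40 * \sum_(0 <= k < j) bitlen (nth 0 w k) + 1)
      (St copy_start M) (St (copy_start + 29) M') /\ copied 0 N' M'.
Proof.
elim: j Nc M => [|j IH] Nc M hj HM.
  exists M, Nc; split=> //; apply: (@reach_le _ 1); first lia.
  by apply: reach_step; rewrite /step /= (copy_at (i := 0) isT) /=; case: HM => [[->]].
have [M1 [N1 [R1 H1]]] := copy_step hj HM.
have [|M2 [N2 [R2 H2]]] := IH _ _ _ H1; first lia.
exists M2, N2; split=> //; apply: reach_le (reach_trans R1 R2).
by rewrite big_nat_recr //=; lia.
Qed.

End Prelude.

Lemma size_prelude : size prelude = 83. Proof. by []. Qed.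

Lemma prelude_ok P w : code_at P 0 prelude ->
  exists base N M s, [/\ reach P (60 + 40 * insize w) (init w) (St 83 M),
    low <= base /\ rep base N M s,
    [/\ size w <= N, N <= 2 * insize w &
        forall k, k < size w -> k != 2 -> nth 0 w k < 2 ^ N],
    (forall k, k < size w -> k != 2 -> s vW k.+1 = nth 0 w k) &
    (forall v j, vidx v != 0 -> s v j = 0)].
Proof.
move=> Hc; have [M [R V0 V3 Vs Vr]] := save_ok w (code_at_catl Hc).
have Hc1 := code_at_catr Hc.
have Hcp : code_at P copy_start copy_code := code_at_catr Hc1.
have := reach_straight M (code_at_catl Hc1) isT; set M1 := foldl _ _ _ => R1.
have EM1 r : 8 < r -> M1 r = M r.
  by move=> hr; rewrite /M1 /= /upd !ifN //; lia.
have inv1 : copied w (size w) 0 M1.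
  split=> //.
  - split; rewrite /M1 /= /upd //= ?V0 ?V3 //; rewrite /low; lia.
  - by move=> j hj; rewrite EM1 ?Vs //; rewrite /low; lia.
  - by move=> r hr; rewrite EM1 ?Vr //; move: hr; rewrite /low; lia.
  - move=> k v; rewrite EM1; last by rewrite /low; lia.
    rewrite ifN; last lia.
    by rewrite Vr ?inp_big //; rewrite /low; lia.
  - by rewrite big_geq // subnn; split=> // k; lia.
have [M2 [N [R2 [[h0 h1 h2 h3 h8] Hs Hr HC [hN1 hN2 hN3]]]]] := copy_ok Hcp (leqnn _) inv1.
exists (size w + low + low), N, M2, (fun v k => M2 (size w + low + low + 64 * k + vidx v)).
have Ein k : k != 2 -> inp w k.+1 = nth 0 w k.
  by move=> hk; rewrite /inp /upd ifN.
have Eins : \sum_(0 <= k < size w) bitlen (nth 0 w k) = insize w.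
  by rewrite /insize [RHS](big_nth 0) big_nat.
split.
- apply: reach_le (reach_trans R (reach_trans R1 R2)).
  by rewrite Eins /=; lia.
- by split; first lia.
- split; first lia.
    by apply: leq_trans hN2 _; rewrite -big_distrr /= Eins.
  by move=> k hk h2'; rewrite -Ein //; apply: hN3.
- by move=> k hk h2'; rewrite HC /= hk Ein.
- by move=> v j /negPf hv; rewrite HC hv.
Qed.

(** * Matchings and auctions *)

Section Matching.
Variables (m n : nat) (el : 'I_m -> 'I_n -> bool).
Implicit Types (S T X Y : {set 'I_m}) (A : {set 'I_n}).

Definition matchable S : Prop :=
  exists f : 'I_m -> 'I_n,
    {in S &, injective f} /\ {in S, forall x, el x (f x)}.

Definition covered X A : Prop := forall x j, x \in X -> el x j -> j \in A.

Definition hall_violator S : Prop :=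
  exists X A, [/\ X \subset S, #|A| < #|X| & covered X A].

(** A certificate that b cannot join S: the players acceptable to Y and b are at most as many as Y.
    It is used instead of unmatchability of [b |: S] because it survives the growth of S and Y can
    be bounded in weight. *)
Definition blocked S b Y : Prop :=
  Y \subset S /\ exists2 A : {set 'I_n}, #|A| <= #|Y| & covered (b |: Y) A.

Lemma covered_card f X A : {in X &, injective f} ->
  {in X, forall x, el x (f x)} -> covered X A -> #|X| <= #|A|.
Proof.
move=> fI fel cA; rewrite -(card_in_imset fI) subset_leq_card //.
by apply/subsetP => _ /imsetP [x xX ->]; apply: cA (fel x xX).
Qed.

(** S itself satisfies Hall's condition, so the violator contains b; without b it is the
    certificate. *)
Lemma violator_blocked S b : matchable S -> hall_violator (b |: S) ->
  exists Y, blocked S b Y.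
Proof.
move=> [f [fI fel]] [X [A [sX ltA cX]]]; exists (X :\ b); split.
  by apply/subsetP => x /setD1P [xb /(subsetP sX)] /setU1P [] // /eqP; rewrite (negPf xb).
have bX : b \in X.
  apply: contraT => bX; suff : #|X| <= #|A| by rewrite leqNgt ltA.
  have sXS : {subset X <= S}.
    by move=> x xX; case/setU1P: (subsetP sX x xX) => // E; rewrite -E xX in bX.
  apply: covered_card cX => [x y /sXS xS /sXS yS|x /sXS xS]; [exact: fI|exact: fel].
by exists A; [move: ltA; rewrite (cardsD1 b X) bX|rewrite setD1K].
Qed.

Lemma blocked_subset S S' b Y : S \subset S' -> blocked S b Y -> blocked S' b Y.
Proof. by move=> sS [sY HA]; split=> //; apply: subset_trans sS. Qed.

(* U collects all subsets of S :&: P whose neighbourhood is exactly their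
   image under the matching f of S; every element of T :&: P outside S has all
   its neighbours in f @: U, so T :&: P cannot outnumber S :&: P. *)
Lemma blocked_leq S T P : matchable S -> matchable T ->
  (forall b, b \in T :&: P -> b \notin S -> exists2 Y, blocked S b Y & Y \subset P) ->
  #|T :&: P| <= #|S :&: P|.
Proof.
move=> [f [fI fel]] [g [gI gel]] HB.
pose closed Y := (Y \subset S :&: P) &&
  [forall x in Y, forall j, el x j ==> (j \in f @: Y)].
pose U := \bigcup_(Y | closed Y) Y.
have sU : U \subset S :&: P by apply/bigcupsP => Y /andP [].
have fU Y : closed Y -> f @: Y \subset f @: U.
  by move=> cY; apply: imsetS; apply: bigcup_sup cY.
have Uclosed x j : x \in U -> el x j -> j \in f @: U.
  case/bigcupP => Y cY xY xj; apply: (subsetP (fU _ cY)).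
  by case/andP: cY => _ /forall_inP/(_ _ xY)/forallP/(_ j)/implyP; apply.
have TU b j : b \in T :&: P -> b \notin S -> el b j -> j \in f @: U.
  move=> bT bS bj; have [Y [sY [A cA HA]] sYP] := HB b bT bS.
  (* The matching sends Y injectively into A, which is no larger than Y, so the image fills A. *)
  have fY : f @: Y = A.
    apply/eqP; rewrite eqEcard (card_in_imset (sub_in2 (subsetP sY) fI)) cA andbT.
    apply/subsetP => _ /imsetP [x xY ->]; apply: (HA x); first by rewrite !inE xY orbT.
    by apply: fel; apply: (subsetP sY).
  have cY : closed Y.
    rewrite /closed subsetI sY sYP /=; apply/forall_inP => x xY; apply/forallP => k.
    by apply/implyP => xk; rewrite fY; apply: (HA x) => //; rewrite !inE xY orbT.
  by apply: (subsetP (fU _ cY)); rewrite fY; apply: (HA b) => //; rewrite !inE eqxx.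
pose Q := ((T :&: P) :\: S) :|: (T :&: U).
have sQ : {subset Q <= T}.
  by move=> x; rewrite !inE => /orP [/and3P [_ ->]|/andP [->]].
have leQ : #|Q| <= #|U|.
  rewrite -(card_in_imset (sub_in2 sQ gI)).
  rewrite -[#|U|](card_in_imset (_ : {in U &, injective f})); last first.
    move=> x y /(subsetP sU) /setIP [xS _] /(subsetP sU) /setIP [yS _]; exact: fI.
  apply: subset_leq_card; apply/subsetP => _ /imsetP [x xQ ->].
  have ex := gel x (sQ x xQ).
  move: xQ; rewrite in_setU => /orP [/setDP [xT xS]|/setIP [_ xU]].
    exact: TU ex.
  exact: Uclosed ex.
have disj : [disjoint (T :&: P) :\: S & T :&: U].
  rewrite disjoint_subset; apply/subsetP => x; rewrite !inE => /andP [/negPf xS _].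
  by apply/negP => /andP [_ /(subsetP sU)]; rewrite inE xS.
have E1 : #|T :&: P| = #|(T :&: P) :\: S| + #|T :&: P :&: S|.
  by rewrite -(cardsID S (T :&: P)) addnC.
have E2 : #|T :&: P :&: S| <= #|T :&: U| + #|(S :&: P) :\: U|.
  apply: leq_trans (leq_card_setU _ _); apply: subset_leq_card.
  by apply/subsetP => x; rewrite !inE; case: (x \in U) => /andP [/andP [-> ->] ->].
have E3 : #|S :&: P| = #|U| + #|(S :&: P) :\: U|.
  by rewrite -(cardsID U (S :&: P)) (setIidPr sU).
move: leQ; rewrite cardsU (disjoint_setI0 disj) cards0 subn0.
lia.
Qed.

(** Layer-cake formula: a weight is the number of thresholds strictly below it. *)
Lemma sum_threshold (w : 'I_m -> nat) S W : (forall v, w v <= W) ->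
  \sum_(v in S) w v = \sum_(t < W) #|S :&: [set v | t < w v]|.
Proof.
move=> hW; under [RHS]eq_bigr => t _ do rewrite -sum1_card.
under [RHS]eq_bigr => t _ do under eq_bigl => v do rewrite !inE.
rewrite (exchange_big_dep (mem S)) /=; last by move=> t v _ /andP [].
apply: eq_bigr => v vS; under eq_bigl => t do rewrite vS /=.
by rewrite -(big_ord_widen _ (fun=> 1) (hW v)) sum1_card card_ord.
Qed.

(** By [blocked_leq], S has at least as many elements of weight at most t as T, for every t. At
    equal size it has no more elements above t, and summing over t compares the weights. *)
Theorem greedy_optimal (w : 'I_m -> nat) (leaf : {set 'I_m}) S T :
  matchable S -> matchable T -> T \subset leaf ->
  (forall b, b \in leaf -> b \notin S ->
     exists2 Y, blocked S b Y & forall x, x \in Y -> w x <= w b) ->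
  #|T| <= #|S| /\ (#|T| = #|S| -> \sum_(v in S) w v <= \sum_(v in T) w v).
Proof.
move=> mS mT sT HB; split.
  have := @blocked_leq S T setT mS mT; rewrite !setIT; apply=> b bT bS.
  by have [Y HY _] := HB b (subsetP sT b bT) bS; exists Y => //; apply: subsetT.
move=> eTS; pose W := \max_(v < m) w v.
have hW v : w v <= W by apply: leq_bigmax.
rewrite !(sum_threshold _ hW); apply: leq_sum => t _.
pose P := [set v | w v <= t].
have Ec (R : {set 'I_m}) : #|R| = #|R :&: P| + #|R :&: [set v | t < w v]|.
  rewrite -(cardsID P R); congr (_ + #|pred_of_set _|).
  by apply/setP => v; rewrite !inE -ltnNge andbC.
have : #|T :&: P| <= #|S :&: P|.
  apply: blocked_leq => // b /setIP [bT]; rewrite inE => bt bS.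
  have [Y HY hY] := HB b (subsetP sT b bT) bS; exists Y => //.
  by apply/subsetP => x /hY xb; rewrite inE (leq_trans xb).
by have := Ec S; have := Ec T; lia.
Qed.

End Matching.

(** * The auction: invariant, progress and certificate of failure *)

Section Auction.
Variables (m n : nat) (el : 'I_m -> 'I_n -> bool) (i0 : 'I_n).
Hypothesis el_i0 : forall x, el x i0 = false.

(* own j is y.+1 if player j holds item y and 0 if j holds nothing; cur is
   y.+1 for the item y that is about to bid and 0 if there is none. *)
Record auction (own price : nat -> nat) (cur : nat) (Q : {set 'I_m}) : Prop :=
  Auction {
    auc_free : forall j : 'I_n, own j = 0 -> price j = 0;
    auc_own : forall (j : 'I_n) (y : 'I_m), own j = y.+1 ->
      [/\ y \in Q, el y j & forall j', el y j' -> price j <= (price j').+1];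
    auc_le : forall j : 'I_n, own j <= m;
    auc_inj : forall j j' : 'I_n, own j = own j' -> own j != 0 -> j = j';
    auc_all : forall y : 'I_m, y \in Q -> cur = y.+1 \/ exists j : 'I_n, own j = y.+1;
    auc_cur : cur != 0 -> (forall j : 'I_n, own j != cur) /\ exists2 y : 'I_m, y \in Q & cur = y.+1;
    auc_price : forall j : 'I_n, price j <= n.+1 }.

Lemma auction0 (own price : nat -> nat) : (forall j : 'I_n, own j = 0) ->
  (forall j : 'I_n, price j = 0) -> auction own price 0 set0.
Proof.
move=> h1 h2; split=> //.
- by move=> j y; rewrite h1.
- by move=> j; rewrite h1.
- by move=> j j' _; rewrite h1.
- by move=> y; rewrite inE.
- by move=> j; rewrite h2.
Qed.

(** Prices and holdings carry over when an item enters, because the invariant constrains prices only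
    through items already held. *)
Lemma auction_add own price Q y : auction own price 0 Q -> y \notin Q ->
  auction own price y.+1 (y |: Q).
Proof.
move=> [h1 h2 h3 h4 h5 h6 h7] yQ; split=> //.
- by move=> j z /h2 [zQ]; split=> //; rewrite inE zQ orbT.
- by move=> z /setU1P [->|/h5 [//|]]; [left|right].
- move=> _; split; last by exists y; rewrite // !inE eqxx.
  by move=> j; apply/eqP => /h2 [yQ']; rewrite yQ' in yQ.
Qed.

Lemma auction_done own price Q : auction own price 0 Q -> matchable el Q.
Proof.
move=> [_ h2 _ _ h5 _ _].
exists (fun y : 'I_m => odflt i0 [pick j : 'I_n | own j == y.+1]); split.
  move=> x y xQ yQ; case: pickP => [j /eqP jx|no].
    case: pickP => [j' /eqP jy /= E|no]; last first.
      by case: (h5 y yQ) => // [[j' /eqP]]; rewrite no.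
    by apply: val_inj; move: jx; rewrite E jy => [[]].
  by case: (h5 x xQ) => // [[j /eqP]]; rewrite no.
move=> x xQ; case: pickP => [j /eqP /h2 [] //|no].
by case: (h5 x xQ) => // [[j /eqP]]; rewrite no.
Qed.

(** Complementary slackness with unit step: the new holder was cheapest, so it ends at most one
    above each alternative; other inequalities persist because no price falls on their right-hand
    side. *)
Lemma auction_bid own price Q (y : 'I_m) (b : 'I_n) :
  auction own price y.+1 Q -> el y b -> price b <= n ->
  (forall j, el y j -> price b <= price j) ->
  auction (upd own b y.+1) (upd price b (price b).+1) (own b) Q.
Proof.
move=> [h1 h2 h3 h4 h5 h6 h7] yb pb hmin.
have [hc [y' yQ [/val_inj E]]] := h6 isT; rewrite -E in yQ.
have pm j : price j <= upd price b (price b).+1 j.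
  by rewrite /upd; case: eqP => // ->.
split.
- move=> j; rewrite /upd; case: eqP => // _; exact: h1.
- move=> j z; rewrite {1 2}/upd; case: (_ =P _) => [/val_inj -> [/val_inj <-]|ne /h2 [zQ zj hz]].
    by split=> // j' /hmin h; rewrite ltnS (leq_trans h).
  by split=> // j' /hz h; rewrite (leq_trans h) // ltnS.
- by move=> j; rewrite /upd; case: eqP.
- move=> j j'; rewrite /upd; case: eqP => [/val_inj ->|_]; case: eqP => [/val_inj -> //|_].
  + by move=> E'; have := hc j'; rewrite -E' eqxx.
  + by move=> E'; have := hc j; rewrite E' eqxx.
  + exact: h4.
- move=> z /h5 [[/val_inj <-]|[j Ej]].
    by right; exists b; rewrite /upd eqxx.
  case: (j =P b) => [<-|/eqP ne]; first by left.
  by right; exists j; rewrite /upd ifN.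
- move=> ob; split.
    move=> j; rewrite /upd; case: (nat_of_ord j =P b) => [_|ne]; first by rewrite eq_sym; apply: hc.
    by apply/eqP => E'; apply: ne; rewrite (h4 j b E') // E'.
  case E': (own b) ob => [//|z] _; have := h3 b; rewrite E' => hz.
  exists (Ordinal hz) => //; by have [] := h2 b (Ordinal hz) E'.
- by move=> j; rewrite /upd; case: eqP => // _; rewrite ltnS.
Qed.

(** A holder must be eligible for its item, so [i0] stays free, and free players cost 0. *)
Lemma auction_price0 own price cur Q : auction own price cur Q -> price i0 = 0.
Proof.
move=> [h1 h2 h3 _ _ _ _]; apply: h1; case E: (own i0) => [//|z].
by have := h3 i0; rewrite E => hz; have [] := h2 i0 (Ordinal hz) E; rewrite el_i0.
Qed.

(** The other n-1 players cost at most n+1 each, and (n-1)(n+1) = n*n - 1. *)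
Lemma auction_sum own price cur Q : auction own price cur Q ->
  \sum_(j < n) price j < n * n.
Proof.
move=> H; have p0 := auction_price0 H; rewrite (bigD1 i0) //= p0 add0n.
have : \sum_(j < n | j != i0) price j <= \sum_(j < n | j != i0) n.+1.
  by apply: leq_sum => j _; case: H.
rewrite sum_nat_const cardC1 card_ord; have : 0 < n := leq_ltn_trans (leq0n i0) (ltn_ord i0).
by move: (\sum_(_ < _ | _) _) => x; clear -x; nia.
Qed.

(* Player i0 keeps price 0, so the n prices miss some level l in 1..n; the
   players above that level, the items they hold and the stuck item violate
   Hall's condition. *)
Lemma auction_fail own price Q (y : 'I_m) :
  auction own price y.+1 Q -> (forall j, el y j -> n < price j) ->
  hall_violator el Q.
Proof.
move=> H hy; have p0 := auction_price0 H.
have [h1 h2 h3 h4 h5 h6 h7] := H.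
have [hc [y' yQ [/val_inj E]]] := h6 isT; rewrite -E in yQ => {y' E}.
have [l /andP [l0 ln] hl] : exists2 l, 0 < l <= n & forall j : 'I_n, price j != l.
  have [l|no] := pickP [pred k : 'I_n | [forall j : 'I_n, price j != k.+1]].
    move=> /forallP hk; exists l.+1 => //=; exact: ltn_ord.
  (* If every level 1..n were attained, choosing a player for each level would be injective and thus
     reach [i0], whose price is 0. *)
  have : forall k : 'I_n, exists j : 'I_n, price j == k.+1.
    by move=> k; have := no k => /= /negbT; rewrite negb_forall => /existsP [j]; rewrite negbK; exists j.
  move=> hex; pose F k := xchoose (hex k).
  have FE k : price (F k) = k.+1 by apply/eqP; apply: (xchooseP (hex k)).
  have FI : injective F by move=> a b /(congr1 (fun j : 'I_n => price j)); rewrite !FE => [[/val_inj]].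
  have : i0 \in codom F by apply: (inj_card_onto FI).
  by case/codomP => k Ek; have := FE k; rewrite -Ek p0.
pose A := [set j : 'I_n | l < price j].
have oA (j : 'I_n) : j \in A -> exists z : 'I_m, own j = z.+1.
  rewrite inE => hj; case Ej: (own j) => [|z]; first by rewrite (h1 _ Ej) in hj.
  by have := h3 j; rewrite Ej => hz; exists (Ordinal hz).
pose X := y |: [set z : 'I_m | [exists j in A, own j == z.+1]].
exists X, A; split.
- apply/subsetP => z /setU1P [-> //|]; rewrite inE => /exists_inP [j _ /eqP /h2 []] //.
- rewrite /X cardsU1 !inE (_ : [exists _ in _, _] = false) /=; last first.
    by apply/negbTE/exists_inP => [[j _ Ej]]; have := hc j; rewrite Ej.
  rewrite add1n ltnS.
  pose G (j : 'I_n) : 'I_m := odflt y [pick z : 'I_m | own j == z.+1].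
  have GE j : j \in A -> own j = (G j).+1.
    move=> /oA [z Ez]; rewrite /G; case: pickP => [z' /eqP //|/(_ z)]; by rewrite Ez eqxx.
  have GI : {in A &, injective G}.
    by move=> a b aA bA E; apply: h4; rewrite ?GE // E.
  rewrite -(card_in_imset GI) subset_leq_card //; apply/subsetP => _ /imsetP [j jA ->].
  by rewrite inE; apply/exists_inP; exists j; rewrite // -GE.
- move=> x j /setU1P [->|].
    by move=> /hy hj; rewrite inE; apply: leq_trans hj; rewrite ltnS.
  (* The holder k costs more than l and at most one more than j, so j costs at least l; since no
     price equals l, it costs more. *)
  rewrite inE => /exists_inP [k kA /eqP /h2 [_ _ hk]] /hk.
  move: kA; rewrite !inE => kA hjk; rewrite ltn_neqAle eq_sym hl /=.
  by rewrite -ltnS (leq_trans kA).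
Qed.

End Auction.

(** * Proportional allocations on stars *)

Section StarAllocation.
Import Order.TTheory GRing.Theory Num.Theory.

Definition star_at (m : nat) (e : rel 'I_m) (c : 'I_m) : Prop :=
  forall x y, e x y = ((x == c) && (y != c)) || ((y == c) && (x != c)).

(* With two vertices each of them is a centre, so c may differ from the centre
   given by is_star. *)
Lemma star_at_center (m : nat) (e : rel 'I_m) (c : 'I_m) : is_star e ->
  (forall y, y != c -> e c y) -> star_at e c.
Proof.
move=> [c0 He] Hc; case: (c0 =P c) => [<- //|/eqP cc0] x y.
have two z : z != c -> z = c0.
  move=> zc; have := Hc z zc; rewrite He [c == c0]eq_sym (negPf cc0) /= andbT.
  by move/eqP.
rewrite He; case: (x =P c) => [->|/eqP/two ->]; case: (y =P c) => [->|/eqP/two ->].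
all: by rewrite ?eqxx ?[c == c0]eq_sym ?(negPf cc0).
Qed.

Lemma star_connected (m : nat) (e : rel 'I_m) c (X : {set 'I_m}) :
  star_at e c -> c \in X -> induces_connected e X.
Proof.
move=> He cX x y xX yX; set r := [rel a b | _].
have toc z : z \in X -> connect r z c /\ connect r c z.
  move=> zX; case: (z =P c) => [->|/eqP zc]; first by rewrite connect0.
  by split; apply: connect1; rewrite /r /= He zX cX eqxx zc ?orbT.
by apply: connect_trans (proj1 (toc x xX)) (proj2 (toc y yX)).
Qed.

(** Every edge meets the centre, so a path inside X cannot have even a first edge. *)
Lemma star_connected_sub1 (m : nat) (e : rel 'I_m) c (X : {set 'I_m}) :
  star_at e c -> c \notin X -> induces_connected e X ->
  {in X &, forall x y, x = y}.
Proof.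
move=> He cX HX x y xX yX; have /connectP [[|z p] /=] := HX x y xX yX; first by [].
have nc t : t \in X -> (t == c) = false.
  by move=> tX; apply/negP => /eqP E; rewrite -E tX in cX.
by case/andP => /and3P [+ _ zX]; rewrite He !nc.
Qed.

Lemma set1_connected (m : nat) (e : rel 'I_m) (x : 'I_m) :
  induces_connected e [set x].
Proof. by move=> y z /set1P -> /set1P ->; apply: connect0. Qed.

Local Open Scope ring_scope.

(** Barring player i, who receives the rest, also provides the never eligible player on which the
    auction relies. *)
Definition wants (n m : nat) (u : 'I_n -> 'I_m -> rat) (i : 'I_n)
    (v : 'I_m) (j : 'I_n) : bool :=
  (j != i) && (n%:R^-1 <= u j v).

(** Since 1/n is positive, all bundles are nonempty, so those without the centre are single leaves.
    Conversely, n-1 matched leaves reach every player but i by counting, and the complement of S is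
    connected through the centre. *)
Theorem star_allocation (n m : nat) (e : rel 'I_m) (u : 'I_n -> 'I_m -> rat) c :
  star_at e c -> utilities u ->
  has_prop_allocation e u <->
  n = 0%N \/ exists (i : 'I_n) (S : {set 'I_m}),
    [/\ c \notin S, matchable (wants u i) S, #|S|.+1 = n &
        \sum_(v in S) u i v <= 1 - n%:R^-1].
Proof.
move=> He [u0 u1]; split.
  move=> [pi [[pc pd] pp]].
  have [n0|n0] := posnP n; [by left|right].
  have nV : 0 < n%:R^-1 :> rat by rewrite invr_gt0 ltr0n.
  (* If nobody holds the centre, any player can serve as i. *)
  have [i ci] : exists i, forall j, j != i -> c \notin pi j.
    case: (pickP (fun i => c \in pi i)) => [i ci|no]; last first.
      by exists (Ordinal n0) => j _; rewrite no.
    exists i => j ji; apply/negP => cj; have := pd j i ji.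
    by rewrite disjoint_subset => /subsetP /(_ c cj); rewrite !inE ci.
  have ne j : exists x, x \in pi j.
    apply/set0Pn/eqP => E; have := pp j; rewrite E big_set0; lra.
  pose g j := xchoose (ne j).
  have gP j : g j \in pi j by apply: (xchooseP (ne j)).
  have gE j : j != i -> pi j = [set g j].
    move=> ji; apply/setP => x; rewrite inE; apply/idP/eqP => [xj|->]; last exact: gP.
    exact: (star_connected_sub1 He (ci j ji) (pc j)).
  have gI : injective g.
    move=> a b E; apply/eqP; apply: contraT => ab; have := pd a b ab.
    by rewrite disjoint_subset => /subsetP /(_ _ (gP a)); rewrite !inE E gP.
  exists i, (g @: [set~ i]); split.
  - apply/imsetP => [[j]]; rewrite !inE => ji E.
    by have := ci j ji; rewrite E gP.
  - exists (fun v => odflt i [pick j | g j == v]); split.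
      move=> _ _ /imsetP [a _ ->] /imsetP [b _ ->].
      case: pickP => [a' /eqP/gI ->|/(_ a)]; last by rewrite eqxx.
      by case: pickP => [b' /eqP/gI -> /= ->|/(_ b)]; last by rewrite eqxx.
    move=> v /imsetP [a]; rewrite !inE => ai ->{v}.
    case: pickP => [a' /eqP/gI ->|/(_ a)]; last by rewrite eqxx.
    by rewrite /wants ai /=; have := pp a; rewrite gE // big_set1.
  - by rewrite card_imset // cardsC1 card_ord prednK.
  - have sub : g @: [set~ i] \subset ~: pi i.
      apply/subsetP => v /imsetP [j]; rewrite !inE => ji ->{v}.
      by have := pd j i ji; rewrite disjoint_subset => /subsetP /(_ _ (gP j)); rewrite inE.
    have h1 : \sum_(v in g @: [set~ i]) u i v <= \sum_(v in ~: pi i) u i v.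
      rewrite [X in _ <= X](big_setID (g @: [set~ i])) /= (setIidPr sub).
      by rewrite lerDl sumr_ge0.
    have h2 : \sum_(v in pi i) u i v + \sum_(v in ~: pi i) u i v = 1.
      rewrite -(u1 i) [RHS](bigID (mem (pi i))) /=; congr (_ + _).
      by apply: eq_bigl => v; rewrite inE.
    by have := pp i; lra.
case=> [n0|[i [S [cS [f [fI fel]] Sn hS]]]].
  exists (fun=> set0); subst n; split; last by case.
  by split; case.
have n0 : (0 < n)%N by rewrite -Sn.
have f_img : f @: S = [set~ i].
  apply/eqP; rewrite eqEcard (card_in_imset fI) cardsC1 card_ord.
  have -> : (n.-1 <= #|S|)%N by rewrite -[#|S|]/(#|S|.+1.-1) Sn.
  rewrite andbT.
  by apply/subsetP => _ /imsetP [x xS ->]; have /andP [] := fel x xS; rewrite !inE.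
pose pi j := if j == i then ~: S else [set v in S | f v == j].
have pij j : j != i -> exists2 v, v \in S & pi j = [set v] /\ f v = j.
  move=> ji; have : j \in f @: S by rewrite f_img !inE.
  case/imsetP => v vS E; exists v => //; split=> //; rewrite /pi (negPf ji).
  apply/setP => x; rewrite !inE; apply/andP/eqP => [[xS /eqP fx]|->].
    by apply: fI; rewrite // fx.
  by rewrite vS E.
exists pi; split; first split.
- move=> j; case: (j =P i) => [->|/eqP ji].
    by rewrite /pi eqxx; apply: star_connected He _; rewrite inE.
  by have [v _ [-> _]] := pij j ji; apply: set1_connected.
- move=> a b ab; rewrite -setI_eq0; apply/eqP/setP => x; rewrite !inE /pi.
  case: (a =P i) => [ai|_]; case: (b =P i) => [bi|_].
  + by rewrite ai bi eqxx in ab.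
  + by rewrite !inE; case: (x \in S).
  + by rewrite !inE; case: (x \in S); rewrite ?andbF.
  + rewrite !inE; case: (x \in S) => //=; case: (f x =P a) => [->|] //=.
    by rewrite (negPf ab).
- move=> j; case: (j =P i) => [->|/eqP ji].
    rewrite /pi eqxx.
    have : \sum_(v in S) u i v + \sum_(v in ~: S) u i v = 1.
      rewrite -(u1 i) [RHS](bigID (mem S)) /=; congr (_ + _).
      by apply: eq_bigl => v; rewrite inE.
    by move: hS; lra.
  have [v vS [-> fv]] := pij j ji; rewrite big_set1.
  by have /andP [_] := fel v vS; rewrite fv.
Qed.

(** Both inequalities are multiplied by n and D. The second is written additively because
    subtraction on naturals truncates. *)
Corollary star_allocation_scaled (n m : nat) (e : rel 'I_m)
    (u : 'I_n -> 'I_m -> rat) c (U : 'I_n -> 'I_m -> nat) (D : nat) :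
  star_at e c -> utilities u -> (0 < D)%N ->
  (forall i v, (U i v)%:R = u i v * D%:R) ->
  has_prop_allocation e u <->
  n = 0%N \/ exists (i : 'I_n) (S : {set 'I_m}),
    [/\ c \notin S, matchable (fun v j => (j != i) && (D <= n * U j v)%N) S,
        #|S|.+1 = n & (n * (\sum_(v in S) U i v) + D <= n * D)%N].
Proof.
move=> He Hu D0 HU; apply: (iff_trans (star_allocation He Hu)).
have D0' : 0 < D%:R :> rat by rewrite ltr0n.
have [n0|n0] := posnP n; first by split=> _; left.
have n0' : 0 < n%:R :> rat by rewrite ltr0n.
have Ew i v j : wants u i v j = (j != i) && (D <= n * U j v)%N.
  rewrite /wants -(ler_nat rat) natrM HU; congr (_ && _).
  rewrite -(ler_pM2r D0') -(ler_pM2l n0') mulrA divff ?mul1r ?mulrA //.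
  by rewrite gt_eqF.
have Es i (S : {set 'I_m}) : (\sum_(v in S) u i v <= 1 - n%:R^-1) =
    (n * (\sum_(v in S) U i v) + D <= n * D)%N.
  rewrite -(ler_nat rat) natrD !natrM natr_sum.
  under [X in _ = (_ * X + _ <= _)]eq_bigr => v _ do rewrite HU.
  rewrite -mulr_suml -(ler_pM2r D0') -(ler_pM2l n0') mulrBl mulrBr mul1r.
  by rewrite [_ * (_^-1 * _)]mulrA divff ?gt_eqF // mul1r lerBrDr.
have Em i S : matchable (wants u i) S <->
    matchable (fun v j => (j != i) && (D <= n * U j v)%N) S.
  by split=> -[f [fI fe]]; exists f; split=> // x /fe; rewrite Ew.
split=> -[h|[i [S [h1 /Em h2 h3 h4]]]]; try (by left); right; exists i, S.
  by split; rewrite // -Es.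
by split; rewrite // Es.
Qed.

End StarAllocation.

(** * The algorithm and its correctness *)

Arguments eval : simpl never.

Local Notation EV v := (EG v (EC 0)).
Local Notation Asg v e := (Put v (EC 0) e).
Local Notation "c1 ;; c2" := (Seq c1 c2) (at level 90, right associativity).

(** The guard lets the rounds after the b-th idle, which fits a variable bound into the fixed N
    rounds. *)
Definition For (i b : var) (c : cmd) : cmd :=
  Asg i (EC 0) ;;
  Loop (If (ES (EV b) (EV i)) (c ;; Asg i (EA (EV i) (EC 1))) Skip).

Definition neqE (e1 e2 : expr) : expr := EA (ES e1 e2) (ES e2 e1).

Lemma neqE_eq0 e1 e2 s : (eeval (neqE e1 e2) s == 0) = (eeval e1 s == eeval e2 s).
Proof. by rewrite /=; lia. Qed.

Ltac ev := repeat match goal with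
  | |- context [eval ?N (Seq ?a ?b) ?s] =>
      change (eval N (Seq a b) s) with (eval N b (eval N a s))
  | |- context [eval ?N (Put ?v ?e1 ?e2) ?s] =>
      change (eval N (Put v e1 e2) s) with (put s v (eeval e1 s) (eeval e2 s))
  | |- context [eval ?N Skip ?s] => change (eval N Skip s) with s
  end.

Lemma eval_if N e c1 c2 s :
  eval N (If e c1 c2) s = if eeval e s == 0 then eval N c2 s else eval N c1 s.
Proof. by []. Qed.

Lemma put_other s v w j x : vidx w != vidx v -> put s v j x w = s w.
Proof. by rewrite /put => /negPf ->. Qed.

Lemma put_same s v j x k : put s v j x v k = if k == j then x else s v k.
Proof. by rewrite /put eqxx. Qed.

Lemma For_ind N i b c s B (I : nat -> store -> Prop) :
  ~~ writes c i -> ~~ writes c b -> vidx b != vidx i -> s b 0 = B -> B <= N ->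
  I 0 (put s i 0 0) ->
  (forall k s', k < B -> s' i 0 = k ->
     (forall v, vidx v != vidx i -> ~~ writes c v -> s' v = s v) ->
     I k s' -> I k.+1 (put (eval N c s') i 0 k.+1)) ->
  I B (eval N (For i b c) s).
Proof.
move=> ci cb bi bB bN I0 IS; pose body := c ;; Asg i (EA (EV i) (EC 1)).
pose st k := iter k (eval N (If (ES (EV b) (EV i)) body Skip)) (put s i 0 0).
suff main k : [/\ st k i 0 = minn k B, I (minn k B) (st k) &
    forall v, vidx v != vidx i -> ~~ writes c v -> st k v = s v].
  have [_ + _] := main N; rewrite (minn_idPr bN); exact.
elim: k => [|k [h1 h2 h3]].
  by rewrite min0n /st /=; split=> [|//|v vi _]; rewrite ?put_same ?put_other.
have -> : st k.+1 = eval N (If (ES (EV b) (EV i)) body Skip) (st k) by [].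
rewrite eval_if /= h1 (h3 b) // bB; case: (ltnP k B) => hk.
  have Ek : minn k B = k by lia.
  have Ek1 : minn k.+1 B = k.+1 by lia.
  rewrite Ek in h1 h2 *; rewrite ifN ?Ek1; last lia.
  have E : eval N body (st k) = put (eval N c (st k)) i 0 k.+1.
    by rewrite /body; ev; rewrite /= eval_frame // h1 addn1.
  rewrite E; split.
  - by rewrite put_same.
  - by apply: IS; rewrite // h1.
  - by move=> v vi cv; rewrite put_other // eval_frame // h3.
have Ek : minn k B = B by lia.
have Ek1 : minn k.+1 B = B by lia.
by rewrite Ek in h1 h2 *; rewrite Ek1 ifT //; lia.
Qed.

Lemma For_add N i b a e s x : vidx b != vidx i -> vidx b != vidx a ->
  vidx a != vidx i -> s b 0 <= N ->
  (forall s', (forall v, vidx v != vidx i -> vidx v != vidx a -> s' v = s v) ->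
     eeval e s' = x) ->
  eval N (For i b (Asg a (EA (EV a) e))) s a 0 = s a 0 + s b 0 * x.
Proof.
move=> bi ba ai bN He.
apply: (For_ind (B := s b 0) (I := fun k s' => s' a 0 = s a 0 + k * x)) => //=.
- by rewrite eq_sym.
- by rewrite put_other // mul0n addn0.
move=> k s' _ _ Fr IH; ev; rewrite put_other // put_same /= IH (He s') //; lia.
Qed.

(** * Arithmetic and preprocessing in the loop language *)

Definition get_bound : cmd := Loop (Asg vN (EA (EV vN) (EC 1))).

(** Expressions cannot read the register that holds N; counting the rounds of one loop makes it
    available as a value. *)
Lemma get_boundP N s : eval N get_bound s vN 0 = s vN 0 + N.
Proof.
pose c := Asg vN (EA (EV vN) (EC 1)).
have H k : iter k (eval N c) s vN 0 = s vN 0 + k; last exact: H.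
elim: k => [|k IH] /=; first by rewrite addn0.
by rewrite /c; ev; rewrite put_same /= IH addn1 addnS.
Qed.

Definition powers : cmd :=
  Put vpw (EC 0) (EC 1) ;;
  For vk vN (Put vpw (EA (EV vk) (EC 1)) (EA (EG vpw (EV vk)) (EG vpw (EV vk)))).

Definition pow_table N (s : store) : Prop :=
  s vN 0 = N /\ forall k, k <= N -> s vpw k = 2 ^ k.

Lemma powersP N s : s vN 0 = N -> pow_table N (eval N powers s).
Proof.
move=> hN; split; first by rewrite eval_frame.
rewrite /powers; ev; set s0 := put _ _ _ _.
have E : s0 vN 0 = N by [].
apply: (For_ind (B := N) (I := fun k s' => forall j, j <= k -> s' vpw j = 2 ^ j)) => //.
- by move=> j; rewrite leqn0 => /eqP ->.
move=> k s' _ hk _ IH j hj; ev; rewrite put_other // put_same /= hk addn1.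
case: eqP => [->|ne]; last by apply: IH; lia.
by rewrite IH // expnS mul2n addnn.
Qed.

(** Horner's rule on the binary digits of e, leading digit first. Only e has to be below 2^N; the
    accumulator may be of any size. *)
Definition mul_acc (e : expr) : cmd :=
  let p := EG vpw (ES (EV vN) (EA (EV vk) (EC 1))) in
  Asg vr (EC 0) ;;
  Asg vrem e ;;
  For vk vN (
    Asg vr (EA (EV vr) (EV vr)) ;;
    If (ES (EA (EV vrem) (EC 1)) p)
       (Asg vr (EA (EV vr) (EV vacc)) ;; Asg vrem (ES (EV vrem) p)) Skip) ;;
  Asg vacc (EV vr).

Lemma mul_accP N e s : pow_table N s -> eeval e (put s vr 0 0) < 2 ^ N ->
  eval N (mul_acc e) s vacc 0 = s vacc 0 * eeval e (put s vr 0 0).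
Proof.
move=> [hN hp]; set x := eeval e _ => hx; rewrite /mul_acc; ev; rewrite -/x.
set s0 := put (put _ _ _ _) _ _ _; set body := (Seq _ _); set s1 := eval N _ s0.
(* Here q is the number formed by the leading digits of x read so far. *)
have : exists q, [/\ x = q * 2 ^ (N - N) + s1 vrem 0, s1 vrem 0 < 2 ^ (N - N) &
    s1 vr 0 = q * s vacc 0].
  apply: (For_ind (B := N) (I := fun k s' => exists q, [/\ x = q * 2 ^ (N - k) + s' vrem 0,
     s' vrem 0 < 2 ^ (N - k) & s' vr 0 = q * s vacc 0])) => //.
    by exists 0; rewrite subn0 /=; split.
  move=> k s' hk hks Fr [q [h1 h2 h3]]; rewrite /body; ev.
  rewrite eval_if /=; set s2 := put s' vr 0 _.
  have e1 : s2 vN 0 = N by rewrite /s2 put_other // Fr.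
  have [e2 e3] : s2 vk 0 = k /\ s2 vrem 0 = s' vrem 0 by [].
  have e4 : s2 vpw (N - k.+1) = 2 ^ (N - k.+1).
    by rewrite /s2 put_other // Fr //; apply: hp; lia.
  have e5 : s2 vr 0 = q.*2 * s vacc 0 by rewrite /s2 put_same /= h3; lia.
  have e6 : s2 vacc 0 = s vacc 0 by rewrite /s2 put_other // Fr.
  have e7 : 2 ^ (N - k) = 2 * 2 ^ (N - k.+1) by rewrite -expnS; congr (2 ^ _); lia.
  clearbody s2; rewrite e1 e2 e3 addn1 addn1 e4 in h1 h2 *; rewrite e7 in h1 h2.
  case: ifP => hc; ev.
    exists q.*2; rewrite !(put_other _ (v := vk)) // e3 e5; split=> //; first lia.
  exists (q.*2.+1); rewrite /put /upd /= e1 e2 e3 addn1 e4 e5 e6; split; lia.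
rewrite subnn; case=> q [h1 h2 h3]; rewrite put_same /= h3.
have E : x = q by move: h1 h2; clearbody x; clear; rewrite expn0; lia.
by rewrite E mulnC.
Qed.

(* The input words start at index 1 of vW: player and item counts, the
   adjacency matrix from index 3, then numerators and denominators. *)
Definition dims : cmd :=
  Asg vn (EG vW (EC 1)) ;; Asg vm (EG vW (EC 2)) ;;
  For vi vn (Asg vT (EA (EV vT) (EV vm))) ;;
  For vi vm (Asg vmm (EA (EV vmm) (EV vm))) ;;
  Asg vT1 (EA (EV vT) (EC 1)).

Lemma dimsP N s : s vW 1 <= N -> s vW 2 <= N -> s vT 0 = 0 -> s vmm 0 = 0 ->
  let s' := eval N dims s in
  [/\ s' vn 0 = s vW 1, s' vm 0 = s vW 2, s' vT 0 = s vW 1 * s vW 2,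
      s' vmm 0 = s vW 2 * s vW 2 & s' vT1 0 = (s vW 1 * s vW 2).+1].
Proof.
move=> h1 h2 hT hmm; rewrite /dims; ev; set s0 := put (put _ _ _ _) _ _ _.
set s1 := eval N (For _ _ _) s0; set s2 := eval N (For _ _ _) s1.
have ET : s1 vT 0 = s vW 1 * s vW 2.
  rewrite /s1 (@For_add N _ _ _ _ _ (s vW 2)) //; first by rewrite [s0 vT 0]hT.
  by move=> s' Fr /=; rewrite Fr.
have E1 v : vidx v != vidx vi -> vidx v != vidx vT -> s1 v = s0 v.
  by move=> h3 h4; rewrite /s1 eval_frame //= (negPf h3) (negPf h4).
have Emm : s2 vmm 0 = s vW 2 * s vW 2.
  rewrite /s2 (@For_add N _ _ _ _ _ (s vW 2)) ?E1 //; first by rewrite [s0 vmm 0]hmm.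
  by move=> s' Fr /=; rewrite Fr // E1.
have E2 v : vidx v != vidx vi -> vidx v != vidx vmm -> s2 v = s1 v.
  by move=> h3 h4; rewrite /s2 eval_frame //= (negPf h3) (negPf h4).
clearbody s2; rewrite /put /upd /= Emm !E2 // ET !E1 //; split=> //.
by rewrite addn1.
Qed.

(** A pointer follows the row-major matrix, which saves computing x*m + y. Diagonal entries are
    skipped, and among several full rows the last one wins. *)
Definition center : cmd :=
  Asg vptr (EC 3) ;;
  For vx vm (
    Asg vbad (EC 0) ;;
    For vy vm (
      If (neqE (EV vx) (EV vy)) (If (EG vW (EV vptr)) Skip (Asg vbad (EC 1))) Skip ;;
      Asg vptr (EA (EV vptr) (EC 1))) ;;
    If (EV vbad) Skip (Asg vctr (EV vx))).

Definition full_row (s : store) (m x : nat) : Prop :=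
  forall y, y < m -> y != x -> s vW (3 + x * m + y) != 0.

Lemma centerP N s : s vm 0 <= N ->
  (exists2 x, x < s vm 0 & full_row s (s vm 0) x) ->
  let c := eval N center s vctr 0 in c < s vm 0 /\ full_row s (s vm 0) c.
Proof.
move=> hm [x0 hx0 Hx0]; rewrite /center; ev; set s0 := put s vptr 0 _ => /=.
set body := Seq (Asg vbad _) _.
have Em : s0 vm 0 = s vm 0 by [].
suff : eval N (For vx vm body) s0 vptr 0 = 3 + s vm 0 * s vm 0 /\
   ((exists2 x, x < s vm 0 & full_row s (s vm 0) x) ->
    let c := eval N (For vx vm body) s0 vctr 0 in c < s vm 0 /\ full_row s (s vm 0) c).
  by case=> _; apply; exists x0.
apply: (For_ind (B := s vm 0) (I := fun k s' => s' vptr 0 = 3 + k * s vm 0 /\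
   ((exists2 x, x < k & full_row s (s vm 0) x) ->
     let c := s' vctr 0 in c < s vm 0 /\ full_row s (s vm 0) c))) => //.
  by split=> // [[]].
move=> k s' hk hks Fr [hptr IH]; rewrite /body; ev.
set s1 := put s' vbad 0 _; set s2 := eval N (For _ _ _) s1.
have F2 v : v = vctr \/ v = vm \/ v = vx \/ v = vW -> s2 v = s' v.
  by move=> hv; rewrite /s2 eval_frame; repeat (case: hv => [->|hv] //); rewrite hv.
have [hp2 hb2] : s2 vptr 0 = 3 + k * s vm 0 + s vm 0 /\ (s2 vbad 0 = 0 <->
   forall y, y < s vm 0 -> y != k -> s vW (3 + k * s vm 0 + y) != 0).
  have E1 : s1 vm 0 = s vm 0 by rewrite /s1 put_other // Fr.
  apply: (For_ind (B := s vm 0) (I := fun j t => t vptr 0 = 3 + k * s vm 0 + j /\ (t vbad 0 = 0 <->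
    forall y, y < j -> y != k -> s vW (3 + k * s vm 0 + y) != 0))) => //.
    by split; rewrite ?addn0.
  move=> j t hj htj Ft [tp tb]; ev; rewrite !eval_if neqE_eq0 /=.
  have tx : t vx 0 = k by rewrite Ft.
  have tW : t vW = s vW by rewrite Ft // /s1 put_other // Fr.
  rewrite htj tx tp tW.
  set t1 := (if _ then _ else _).
  have [e1 e2] : t1 vptr = t vptr /\ (t1 vbad 0 = 0 <-> t vbad 0 = 0 /\
      (j != k -> s vW (3 + k * s vm 0 + j) != 0)).
    rewrite /t1; case: (k =P j) => [->|ne]; first by rewrite eqxx; split=> //; split=> [|[]].
    have -> : j != k by apply/eqP => E; apply: ne.
    case: eqP => [_|ne'].
      by ev; rewrite put_same /=; split=> //; split=> // [[_ /(_ isT)]].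
    by split=> //; split=> [|[]].
  rewrite !(put_other _ (v := vy)) // put_same /= e1 tp put_other //.
  split; first by rewrite addn1 addnS.
  split.
    move/e2 => [/tb h1 h2] y; rewrite ltnS leq_eqVlt => /predU1P [->|] //; exact: h1.
  move=> h; apply/e2; split; last by apply: h.
  by apply/tb => y hy; apply: h; lia.
rewrite eval_if /=; case: eqP => [h|h]; ev; rewrite !(put_other _ (v := vx)) //; last first.
  rewrite hp2 F2 //; last by auto.
  split; first lia.
  move=> [x hx Hx]; apply: IH; exists x => //.
  rewrite ltnS leq_eqVlt in hx; case/predU1P: hx => // E; case: h.
  by rewrite E in Hx; apply/hb2 => y hy yk; apply: Hx.
rewrite put_other // put_same /= hp2 F2 ?hks; last by auto.
split; first lia.
by move=> _; split=> // y hy yk; apply: (proj1 hb2 h).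
Qed.

Lemma For_frame N i b c s v : vidx v != vidx i -> ~~ writes c v ->
  eval N (For i b c) s v = s v.
Proof. by move=> h1 h2; rewrite eval_frame //= (negPf h1) (negPf h2). Qed.

(* Cell t < T of vU receives u_t times the product D of all denominators, and
   cell T receives D itself. *)
Definition normalize : cmd :=
  For vt vT1 (
    If (ES (EV vT) (EV vt))
       (Asg vacc (EG vW (EA (EA (EC 3) (EV vmm)) (EA (EV vt) (EV vt)))))
       (Asg vacc (EC 1)) ;;
    For vq vT (
      If (neqE (EV vq) (EV vt))
         (mul_acc (EG vW (EA (EA (EC 4) (EV vmm)) (EA (EV vq) (EV vq))))) Skip) ;;
    Put vU (EV vt) (EV vacc)).

(** Multiplying the numerator by all denominators except its own gives the scaled utility without
    division; at t = T none is left out and the result is D. *)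
Lemma normalizeP N s T (num den : nat -> nat) : pow_table N s -> s vT 0 = T -> s vT1 0 = T.+1 ->
  T < N -> (forall t, t < T -> s vW (3 + s vmm 0 + (t + t)) = num t) ->
  (forall t, t < T -> s vW (4 + s vmm 0 + (t + t)) = den t) ->
  (forall t, t < T -> den t < 2 ^ N) ->
  forall t, t <= T -> eval N normalize s vU t =
    (if t < T then num t else 1) * \prod_(q < T) (if q == t :> nat then 1 else den q).
Proof.
move=> [hN hp] hT hT1 TN hnum hden hlt t; rewrite -ltnS => ht.
pose F t := (if t < T then num t else 1) *
  \prod_(q < T) (if q == t :> nat then 1 else den q).
rewrite -[RHS]/(F t); move: t ht.
apply: (For_ind (B := T.+1) (I := fun k s' => forall t, t < k -> s' vU t = F t)) => //.
move=> k s' hk hks Fr IH; ev; set s1 := eval N (If _ _ _) s'.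
have F1 v : vidx v != vidx vacc -> s1 v = s' v.
  by move=> h; rewrite /s1 eval_frame //= (negPf h).
have E1 : s1 vacc 0 = if k < T then num k else 1.
  rewrite /s1 eval_if /= (Fr vT) // hT hks subn_eq0.
  case: leqP => h; ev; rewrite put_same //= hks (Fr vW) // (Fr vmm) //.
  exact: hnum.
set s2 := eval N (For _ _ _) s1.
have E2 : s2 vacc 0 = F k.
  rewrite /F -E1.
  apply: (For_ind (B := T) (I := fun j t => t vacc 0 = s1 vacc 0 *
    \prod_(q < j) (if q == k :> nat then 1 else den q))) => //.
  - by rewrite F1 // Fr.
  - by lia.
  - by rewrite big_ord0 muln1.
  move=> j t hj htj Ft IHt; rewrite put_other // eval_if neqE_eq0.
  rewrite [eeval (EV vq) t]htj [eeval (EV vt) t](_ : _ = k); last by rewrite /= Ft // F1.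
  rewrite big_ord_recr /= mulnA -IHt; case: ifP => jk; first by ev; rewrite muln1.
  have Ee : eeval (EG vW (EA (EA (EC 4) (EV vmm)) (EA (EV vq) (EV vq)))) (put t vr 0 0) = den j.
    by rewrite /= !put_other // htj !Ft // !F1 // !Fr // hden.
  have PT : pow_table N t by split=> [|a]; rewrite Ft // F1 // Fr //; apply: hp.
  by have := mul_accP PT; move/(_ _ (eq_ind_r (fun z => z < _) (hlt j hj) Ee)) ->; rewrite Ee.
move=> t ht; rewrite put_other // put_same /=.
have -> : s2 vt 0 = k by rewrite /s2 For_frame // F1.
case: eqP => [-> //|ne]; have -> : s2 vU = s' vU by rewrite /s2 For_frame // F1.
by apply: IH; lia.
Qed.

(** The nested truncated subtraction is a comparison: it is 1 if D is at most n times the scaled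
    utility, and 0 otherwise. *)
Definition eligible : cmd :=
  For vt vT (
    Asg vacc (EC 0) ;;
    For vq vn (Asg vacc (EA (EV vacc) (EG vU (EV vt)))) ;;
    Put vE (EV vt) (ES (EC 1) (ES (EG vU (EV vT)) (EV vacc)))).

Lemma eligibleP N s n T : s vn 0 = n -> s vT 0 = T -> n <= N -> T <= N ->
  forall t, t < T ->
  (eval N eligible s vE t != 0) = (s vU T <= n * s vU t).
Proof.
move=> hn hT nN TN.
apply: (For_ind (B := T) (I := fun k s' => forall t, t < k ->
  (s' vE t != 0) = (s vU T <= n * s vU t))) => //.
move=> k s' hk hks Fr IH; ev; set s1 := put s' vacc 0 _; set s2 := eval N (For _ _ _) s1.
have E2 : s2 vacc 0 = n * s vU k.
  rewrite /s2 (@For_add N _ _ _ _ _ (s vU k)) //.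
  - by rewrite [s1 vn]Fr // hn.
  - by rewrite [s1 vn]Fr // hn.
  - by move=> s3 F3; rewrite /= (F3 vt) // (F3 vU) // [s1 vU]Fr // [s1 vt 0]hks.
have F2 v : vidx v != vidx vq -> vidx v != vidx vacc -> s2 v = s' v.
  by move=> h1 h2; rewrite /s2 For_frame //= /s1 put_other.
move=> t ht; rewrite put_other // put_same /= E2 !F2 // hks !(Fr vT) // !(Fr vU) // hT.
by case: (t =P k) => [->|ne]; [lia|apply: IH; lia].
Qed.

(** * The auction as a program *)

Definition scan_players : cmd :=
  Asg vbp (EA (EV vn) (EC 1)) ;; Asg vjm (EC 0) ;;
  For vj vn (
    If (neqE (EV vj) (EV vi))
      (If (EG vE (EA (EV vjm) (ES (EV vcur) (EC 1))))
        (If (ES (EV vbp) (EG vprice (EV vj)))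
           (Asg vbp (EG vprice (EV vj)) ;; Asg vbj (EV vj)) Skip) Skip) Skip ;;
    Asg vjm (EA (EV vjm) (EV vm))).

Definition bid : cmd :=
  scan_players ;;
  If (ES (EA (EV vn) (EC 1)) (EV vbp))
     (Put vprice (EV vbj) (EA (EG vprice (EV vbj)) (EC 1)) ;;
      Asg vtmp (EG vown (EV vbj)) ;;
      Put vown (EV vbj) (EV vcur) ;;
      Asg vcur (EV vtmp))
     (Asg vfail (EC 1) ;; Asg vcur (EC 0)).

Section Auction.
Variables (N n m : nat) (s00 : store) (i : 'I_n).
Hypotheses (nN : n <= N) (mN : m <= N).

(** [s00] freezes the eligibility table, so that [el] remains one fixed relation while the store
    evolves. *)
Definition setting (s : store) : Prop :=
  [/\ s vn 0 = n, s vm 0 = m, s vi 0 = i & s vE = s00 vE].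

Definition elig (y : nat) (j : nat) : bool := (j != i) && (s00 vE (j * m + y) != 0).
Definition el (y : 'I_m) (j : 'I_n) : bool := elig y j.

Lemma el_i y : el y i = false.
Proof. by rewrite /el /elig eqxx. Qed.

Lemma setting_frame c s : ~~ writes c vn -> ~~ writes c vm -> ~~ writes c vi ->
  ~~ writes c vE -> setting s -> setting (eval N c s).
Proof. by move=> h1 h2 h3 h4 [*]; split; rewrite eval_frame. Qed.

(** [vbp] starts at n+1 and only a strictly lower price replaces it, so a final n+1 means that every
    eligible player costs more than n. *)
Lemma scan_playersP s y : setting s -> s vcur 0 = y.+1 ->
  let s' := eval N scan_players s in
  (forall j, j < n -> elig y j -> s' vbp 0 <= s vprice j) /\
  (s' vbp 0 = n.+1 \/
   [/\ s' vbp 0 <= n, s' vbj 0 < n, elig y (s' vbj 0) & s vprice (s' vbj 0) = s' vbp 0]).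
Proof.
move=> [sn sm si sE] hy; rewrite /scan_players; ev; set s0 := put (put s _ _ _) _ _ _ => /=.
pose I k (s' : store) := s' vjm 0 = k * m /\
 ((forall j, j < k -> elig y j -> s' vbp 0 <= s vprice j) /\
  (s' vbp 0 = n.+1 \/
   [/\ s' vbp 0 <= n, s' vbj 0 < n, elig y (s' vbj 0) & s vprice (s' vbj 0) = s' vbp 0])).
set c := For _ _ _; suff : I n (eval N c s0) by case.
rewrite /c; apply: For_ind => //.
  by split=> //; split=> //; left; rewrite /s0 /put /upd /= sn addn1.
move=> k s' hk hks Fr [hjm [IH1 IH2]]; ev; set s1 := eval N (If _ _ _) s'.
have F1 v : vidx v != vidx vbp -> vidx v != vidx vbj -> s1 v = s' v.
  by move=> h1 h2; rewrite /s1 eval_frame //= (negPf h1) (negPf h2).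
have [e1 e2 e3 e4 e5] : [/\ s' vi 0 = i, s' vE = s00 vE, s' vcur 0 = y.+1,
    s' vprice = s vprice & s' vm 0 = m] by split; rewrite Fr.
rewrite /I /put /upd /= (F1 vjm) // hjm (F1 vm) // e5.
split; first lia.
have Hs : (~~ elig y k || (s' vbp 0 <= s vprice k) /\ s1 = s') \/
   [/\ elig y k, s vprice k < s' vbp 0, s1 vbp 0 = s vprice k & s1 vbj 0 = k].
  rewrite /s1 eval_if neqE_eq0 /= hks e1 /elig.
  case: eqP => [->|/eqP ki] /=; first by left; split.
  rewrite eval_if /= hjm e3 subn1 e2 /=.
  case: eqP => [h|/eqP h] /=; first by left; split.
  rewrite eval_if /= hks e4 subn_eq0; case: leqP => hb; first by left; split.
  by right; split=> //; ev; rewrite /put /upd /= hks e4.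
case: Hs => [[h ->]|[h1 h2 -> ->]].
  split=> // j; rewrite ltnS leq_eqVlt => /predU1P [->|]; last exact: IH1.
  by move=> hel; rewrite hel in h.
split.
  move=> j; rewrite ltnS leq_eqVlt => /predU1P [-> //|hj hel].
  by apply: leq_trans (IH1 j hj hel); apply: ltnW.
by right; split=> //; case: IH2 => [|[]]; lia.
Qed.

Lemma bidP s Q (y : 'I_m) : setting s -> s vcur 0 = y.+1 -> s vfail 0 = 0 ->
  auction el (s vown) (s vprice) y.+1 Q ->
  let s' := eval N bid s in
  [/\ s' vfail 0 = 1, s' vcur 0 = 0 & hall_violator el Q] \/
  [/\ s' vfail 0 = 0, auction el (s' vown) (s' vprice) (s' vcur 0) Q &
      \sum_(j < n) s' vprice j = (\sum_(j < n) s vprice j).+1].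
Proof.
move=> Hs hy hf HA; rewrite /bid; ev; set s1 := eval N scan_players s => /=.
have [h1 h2] := scan_playersP Hs hy; rewrite -/s1 in h1 h2.
have F1 v : vidx v != vidx vbp -> vidx v != vidx vbj -> vidx v != vidx vjm ->
    vidx v != vidx vj -> s1 v = s v.
  by move=> a1 a2 a3 a4; rewrite /s1 eval_frame //= (negPf a1) (negPf a2) (negPf a3) (negPf a4).
have [sn _ _ _] := Hs.
rewrite eval_if /= F1 // sn addn1 subn_eq0.
case: h2 => [E|[hb hj hel hp]].
  rewrite E leqnn; left; ev; split=> //.
  by apply: (auction_fail el_i HA) => j hj; rewrite -ltnS -E; apply: h1.
right; rewrite ifN; last by rewrite -ltnNge ltnS.
clearbody s1; ev; rewrite /put /upd /= (F1 vown) // (F1 vprice) // (F1 vcur) // (F1 vfail) // hy.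
pose b : 'I_n := Ordinal hj.
have Hb : auction el (upd (s vown) b y.+1) (upd (s vprice) b (s vprice b).+1) (s vown b) Q.
  apply: auction_bid HA _ _ _ => //=; first by rewrite hp.
  by move=> j hj'; rewrite hp; apply: h1.
split=> //; first by rewrite addn1.
rewrite (bigD1 b) // [in RHS](bigD1 b) //= eqxx addn1 addSn; congr (_ + _).+1.
by apply: eq_bigr => j jb; rewrite ifN.
Qed.

Definition chain : cmd := Loop (Loop (If (EV vcur) bid Skip)).

(** While a bidder is pending, the sum of the prices is at least the number of rounds made; as it
    stays below n*n, the N*N rounds end with no bidder. *)
Lemma chainP s Q : setting s -> s vfail 0 = 0 ->
  auction el (s vown) (s vprice) (s vcur 0) Q ->
  let s' := eval N chain s in
  s' vfail 0 = 1 /\ hall_violator el Q \/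
  s' vfail 0 = 0 /\ auction el (s' vown) (s' vprice) 0 Q.
Proof.
move=> Hs hf HA; pose f := eval N (If (EV vcur) bid Skip).
have EN k : iter k (fun t => iter N f t) s = iter (k * N) f s.
  by elim: k => //= k ->; rewrite -iterD mulSn.
have -> /= : eval N chain s = iter (N * N) f s by rewrite -EN.
have inv k : setting (iter k f s) /\
  ([/\ iter k f s vfail 0 = 1, iter k f s vcur 0 = 0 & hall_violator el Q] \/
   [/\ iter k f s vfail 0 = 0,
       auction el (iter k f s vown) (iter k f s vprice) (iter k f s vcur 0) Q &
       iter k f s vcur 0 = 0 \/ k <= \sum_(j < n) iter k f s vprice j]).
  elim: k => [|k [IH1 IH2]]; first by split=> //; right; split=> //; right.
  rewrite iterS; move: (iter k f s) IH1 IH2 => t Ht IH2; split.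
    by apply: setting_frame.
  rewrite /f eval_if /=; case: IH2 => [[h1 h2 h3]|[h1 h2 h3]].
    by rewrite h2 /=; ev; left.
  case: eqP => [h0|/eqP h0]; first by ev; right; split=> //; left.
  have [_ [y yQ hy]] := auc_cur h2 h0; rewrite hy in h2.
  case: (bidP Ht hy h1 h2) => [?|[a1 a2 a3]]; [by left|right; split=> //].
  by right; rewrite a3 ltnS; case: h3 => // h; rewrite h in h0.
have [_ [[]|[h1 h2 h3]]] := inv (N * N); [by left|right].
case: h3 => [h3|h3]; first by rewrite h3 in h2.
by have := auction_sum el_i h2; have : n * n <= N * N by [apply: leq_mul]; lia.
Qed.

Definition test : cmd :=
  For vj vn (Put vown (EV vj) (EC 0) ;; Put vprice (EV vj) (EC 0)) ;;
  Asg vfail (EC 0) ;; Asg vcur (EC 0) ;;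
  For vx vm (If (EV vfail) Skip
    (If (EG vsel (EV vx)) (Asg vcur (EA (EV vx) (EC 1)) ;; chain ;; Asg vcur (EC 0)) Skip)).

Definition selected (s : store) : {set 'I_m} := [set x : 'I_m | s vsel x != 0].

Lemma testP s : setting s ->
  let s' := eval N test s in
  s' vfail 0 = 1 /\ hall_violator el (selected s) \/
  s' vfail 0 = 0 /\ matchable el (selected s).
Proof.
move=> Hs; have [sn sm si sE] := Hs; rewrite /test; ev; set s1 := eval N (For _ _ _) s.
have [z1 z2] : (forall j, j < n -> s1 vown j = 0) /\ (forall j, j < n -> s1 vprice j = 0).
  apply: (For_ind (B := n) (I := fun k t => (forall j, j < k -> t vown j = 0) /\
     (forall j, j < k -> t vprice j = 0))) => //.
  move=> k t hk htk _ [h1 h2]; ev; rewrite /put /upd /= htk; split=> j hj;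
    case: eqP => // ne; [apply: h1|apply: h2]; lia.
have F1 v : vidx v != vidx vj -> vidx v != vidx vown -> vidx v != vidx vprice -> s1 v = s v.
  by move=> a1 a2 a3; rewrite /s1 For_frame //= (negPf a2) (negPf a3).
set s2 := put (put s1 _ _ _) _ _ _ => /=.
have Hs2 : setting s2.
  by split; rewrite /s2 !put_other // F1.
have : forall s', s' vfail 0 = 1 /\ hall_violator el (selected s) \/
    [/\ s' vfail 0 = 0, s' vcur 0 = 0 &
      auction el (s' vown) (s' vprice) 0 [set x in selected s | x < m]] ->
    s' vfail 0 = 1 /\ hall_violator el (selected s) \/
    s' vfail 0 = 0 /\ matchable el (selected s).
  move=> s' [|[h1 h2 h3]]; [by left|right; split=> //].
  have -> : selected s = [set x in selected s | x < m].
    by apply/setP => x; rewrite inE ltn_ord andbT.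
  exact: (auction_done i h3).
apply; apply: (For_ind (B := m) (I := fun k s' =>
   s' vfail 0 = 1 /\ hall_violator el (selected s) \/
    [/\ s' vfail 0 = 0, s' vcur 0 = 0 &
    auction el (s' vown) (s' vprice) 0 [set x in selected s | x < k]])) => //.
- by rewrite [s2 vm]F1.
- right; split=> //; rewrite (_ : [set _ in _ | _] = set0).
    by apply: auction0 => j; [apply: z1|apply: z2].
  by apply/setP => x; rewrite !inE andbF.
move=> k t hk htk Fr IH; rewrite !put_other //.
have Ht : setting t by have [? ? ? ?] := Hs2; split; rewrite Fr.
rewrite eval_if /=; case: IH => [[h1 h2]|[h1 hc h2]]; first by rewrite h1 /=; left.
rewrite h1 /= eval_if /= htk.
have Esel : t vsel = s vsel by rewrite Fr // /s2 !put_other // F1.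
rewrite Esel; case: eqP => [h0|/eqP h0]; ev.
  right; split=> //; rewrite (_ : [set _ in _ | _] = [set x in selected s | x < k]) //.
  apply/setP => x; rewrite !inE ltnS leq_eqVlt.
  by case: (nat_of_ord x =P k) => //= ->; rewrite h0.
pose x : 'I_m := Ordinal hk.
set t1 := put t vcur 0 _; have Ht1 : setting t1 by case: Ht => *; split.
have HA : auction el (t1 vown) (t1 vprice) (t1 vcur 0) (x |: [set x in selected s | x < k]).
  have -> : t1 vcur 0 = x.+1 by rewrite /t1 put_same /= htk addn1.
  by apply: auction_add => //; rewrite !inE ltnn andbF.
have EQ : x |: [set x in selected s | x < k] = [set x in selected s | x < k.+1].
  apply/setP => y; rewrite !inE ltnS [y <= k]leq_eqVlt -val_eqE /=.
  by case: (nat_of_ord y =P k) => [->|] //=; rewrite h0.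
rewrite EQ in HA.
rewrite /put /= -/put; case: (chainP Ht1 h1 HA) => [[a1 a2]|[a1 a2]]; [left|right]; split=> //.
(* A violator among the items entered so far is also one for the whole selection. *)
have [X [A [b1 b2 b3]]] := a2; exists X, A; split=> //.
by apply: subset_trans b1 _; apply/subsetP => y; rewrite inE => /andP [].
Qed.

End Auction.

(** * Greedy selection of a lightest matchable set *)

Definition pick : cmd :=
  Asg vbest (EC 0) ;; Asg vbw (EA (EG vU (EV vT)) (EC 1)) ;;
  For vx vm (
    If (EG vdone (EV vx)) Skip
      (If (ES (EV vbw) (EG vU (EA (EV vim) (EV vx))))
         (Asg vbw (EG vU (EA (EV vim) (EV vx))) ;; Asg vbest (EA (EV vx) (EC 1)))
         Skip)).

(** The search starts from D+1, which exceeds every weight, so any pending item beats it; [vbest] is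
    shifted by one to let 0 mean that none is pending. *)
Lemma pickP N s m (w : nat -> nat) : s vm 0 = m -> m <= N ->
  (forall x, x < m -> s vU (s vim 0 + x) = w x) ->
  (forall x, x < m -> w x <= s vU (s vT 0)) ->
  let s' := eval N pick s in
  s' vbest 0 = 0 /\ (forall x, x < m -> s vdone x != 0) \/
  exists b, [/\ b < m, s' vbest 0 = b.+1, s vdone b = 0, s' vbw 0 = w b &
    forall x, x < m -> s vdone x = 0 -> w b <= w x].
Proof.
move=> sm mN hw hwD; rewrite /pick; ev; set s0 := put (put s _ _ _) _ _ _ => /=.
pose D := s vU (s vT 0).
pose I k (t : store) :=
  [/\ t vbest 0 = 0, t vbw 0 = D.+1 & forall x, x < k -> s vdone x != 0] \/
  exists b, [/\ b < m, t vbest 0 = b.+1, s vdone b = 0, t vbw 0 = w b &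
    forall x, x < k -> s vdone x = 0 -> w b <= w x].
set c := For _ _ _; suff : I m (eval N c s0) by case=> [[]|]; [left|right].
rewrite /c; apply: For_ind => //.
  by left; split=> //; rewrite put_other // /s0 put_same /= addn1.
move=> k t hk htk Fr IH; rewrite /I !put_other // eval_if /= htk.
have [e1 e2 e3] : [/\ t vdone = s vdone, t vim = s vim & t vU = s vU] by split; rewrite Fr.
rewrite e1; case: eqP => [h0|/eqP h0]; last first.
  ev; case: IH => [[h1 h2 h3]|[b [h1 h2 h3 h4 h5]]].
    left; split=> // x; rewrite ltnS leq_eqVlt => /predU1P [-> //|]; exact: h3.
  right; exists b; split=> // x; rewrite ltnS leq_eqVlt => /predU1P [->|]; last exact: h5.
  by move=> h; rewrite h in h0.
rewrite eval_if /= htk e2 e3 hw // subn_eq0.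
case: leqP => hb; ev.
  case: IH => [[h1 h2 h3]|[b [h1 h2 h3 h4 h5]]].
    by have := hwD k hk; rewrite -/D; lia.
  right; exists b; split=> // x; rewrite ltnS leq_eqVlt => /predU1P [->|]; last exact: h5.
  by rewrite -h4.
right; exists k; rewrite /put /upd /= htk e2 e3 hw // addn1; split=> // x.
rewrite ltnS leq_eqVlt => /predU1P [-> //|hx hd].
case: IH => [[h1 h2 h3]|[b [h1 h2 h3 h4 h5]]].
  by have := h3 x hx; rewrite hd.
by have := h5 x hx hd; lia.
Qed.

Definition try_best : cmd :=
  Put vdone (ES (EV vbest) (EC 1)) (EC 1) ;;
  Put vsel (ES (EV vbest) (EC 1)) (EC 1) ;;
  test ;;
  If (EV vfail)
     (Put vsel (ES (EV vbest) (EC 1)) (EC 0))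
     (Asg vcnt (EA (EV vcnt) (EC 1)) ;; Asg vwt (EA (EV vwt) (EV vbw))).

Definition greedy : cmd :=
  Asg vcnt (EC 0) ;; Asg vwt (EC 0) ;;
  For vx vm (Put vsel (EV vx) (EC 0) ;; Put vdone (EV vx) (EC 0)) ;;
  Put vdone (EV vctr) (EC 1) ;;
  For vs vm (pick ;; If (EV vbest) try_best Skip).

Section Greedy.
Variables (N n m : nat) (s00 : store) (i : 'I_n) (c : 'I_m) (w : nat -> nat).
Hypotheses (nN : n <= N) (mN : m <= N).
Local Notation el := (@el n m s00 i).
Local Notation selected := (@selected m).

(** [gi_le] records the order of processing, from which a rejected item gets a certificate no
    heavier than itself; [gi_left] ensures that m rounds settle every item. *)
Record greedy_inv (k : nat) (t : store) : Prop := GreedyInv {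
  gi_done : forall x : 'I_m, t vsel x != 0 -> t vdone x != 0 /\ x != c;
  gi_le : forall x y : 'I_m, t vsel x != 0 -> t vdone y = 0 -> w x <= w y;
  gi_match : matchable el (selected t);
  gi_block : forall b : 'I_m, b != c -> t vdone b != 0 -> t vsel b = 0 ->
    exists2 Y, blocked el (selected t) b Y & forall x, x \in Y -> w x <= w b;
  gi_cnt : t vcnt 0 = #|selected t|;
  gi_wt : t vwt 0 = \sum_(x in selected t) w x;
  gi_left : #|[set x : 'I_m | t vdone x == 0]| <= m - k;
  gi_ctr : t vdone c != 0 }.

Lemma greedy_inv_ext k t t' : t' vsel = t vsel -> t' vdone = t vdone ->
  t' vcnt = t vcnt -> t' vwt = t vwt -> greedy_inv k t -> greedy_inv k t'.
Proof.
move=> e1 e2 e3 e4 [h1 h2 h3 h4 h5 h6 h7 h8].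
have eS : selected t' = selected t by apply/setP => x; rewrite !inE e1.
by split; rewrite ?eS ?e1 ?e2 ?e3 ?e4.
Qed.

Lemma left_decr k (f : nat -> nat) (b : 'I_m) :
  #|[set x : 'I_m | f x == 0]| <= m - k -> f b = 0 ->
  #|[set x : 'I_m | upd f b 1 x == 0]| <= m - k.+1.
Proof.
move=> h hb; have -> : [set x : 'I_m | upd f b 1 x == 0] = [set x : 'I_m | f x == 0] :\ b.
  by apply/setP => x; rewrite !inE /upd -val_eqE /=; case: (nat_of_ord x =P b).
by move: h; rewrite (cardsD1 b) inE hb eqxx; lia.
Qed.

(** Earlier certificates remain valid because [blocked] is monotone in the selection. *)
Lemma accept_inv k t t' (b : 'I_m) : greedy_inv k t -> t vdone b = 0 ->
  (forall x : 'I_m, t vdone x = 0 -> w b <= w x) ->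
  t' vdone = upd (t vdone) b 1 -> t' vsel = upd (t vsel) b 1 ->
  t' vcnt 0 = (t vcnt 0).+1 -> t' vwt 0 = t vwt 0 + w b ->
  matchable el (selected t') -> greedy_inv k.+1 t'.
Proof.
move=> [h1 h2 h3 h4 h5 h6 h7 h8] hb hmin e1 e2 e3 e4 hm.
have sb : t vsel b = 0 by apply/eqP; apply: contraT => /h1 [/eqP].
have bS : b \notin selected t by rewrite inE sb.
have ES : selected t' = b |: selected t.
  apply/setP => x; rewrite !inE e2 /upd -val_eqE /=; by case: (nat_of_ord x =P b).
have bc : b != c by apply: contraNneq h8 => <-; rewrite hb.
split=> //.
- move=> x; rewrite e1 e2 /upd; case: (nat_of_ord x =P b) => [/val_inj -> //|_]; exact: h1.
- move=> x y; rewrite e1 e2 /upd; case: (nat_of_ord y =P b) => // _.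
  case: (nat_of_ord x =P b) => [-> _|_]; [exact: hmin|exact: h2].
- move=> x xc; rewrite e1 e2 /upd; case: (nat_of_ord x =P b) => // _ dx sx.
  have [Y HY hY] := h4 x xc dx sx; exists Y => //.
  by apply: blocked_subset HY; rewrite ES subsetUr.
- by rewrite e3 ES cardsU1 bS h5.
- by rewrite e4 ES big_setU1 //= h6 addnC.
- by rewrite e1; apply: left_decr.
- by rewrite e1 /upd; case: ifP.
Qed.

(** The failed test yields a Hall violator, hence a certificate inside the selection; [gi_le] bounds
    its weights since b was still pending. *)
Lemma reject_inv k t t' (b : 'I_m) : greedy_inv k t -> t vdone b = 0 ->
  t' vdone = upd (t vdone) b 1 -> t' vsel = upd (upd (t vsel) b 1) b 0 ->
  t' vcnt 0 = t vcnt 0 -> t' vwt 0 = t vwt 0 ->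
  hall_violator el (b |: selected t) -> greedy_inv k.+1 t'.
Proof.
move=> [h1 h2 h3 h4 h5 h6 h7 h8] hb e1 e2 e3 e4 hm.
have sb : t vsel b = 0 by apply/eqP; apply: contraT => /h1 [/eqP].
have Es x : t' vsel x = t vsel x.
  by rewrite e2 /upd; case: eqP => // ->; rewrite sb.
have ES : selected t' = selected t by apply/setP => x; rewrite !inE Es.
split; rewrite ?ES ?e3 ?e4 //.
- by move=> x; rewrite Es e1 /upd => /h1 [? ?]; split=> //; case: ifP.
- move=> x y; rewrite Es e1 /upd; case: (nat_of_ord y =P b) => // _; exact: h2.
- move=> x xc; rewrite Es e1 /upd; case: (nat_of_ord x =P b) => [/val_inj -> _ _|_ dx sx].
    have [Y HY] := violator_blocked h3 hm; exists Y => // x' xY.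
    by apply: h2 hb; have [/subsetP /(_ _ xY)] := HY; rewrite inE.
  exact: h4.
- by rewrite e1; apply: left_decr.
- by rewrite e1 /upd; case: ifP.
Qed.

Lemma greedyP s : setting m s00 i s -> s vctr 0 = c ->
  (forall x, x < m -> s vU (s vim 0 + x) = w x) ->
  (forall x, x < m -> w x <= s vU (s vT 0)) ->
  let s' := eval N greedy s in
  exists S : {set 'I_m}, [/\ c \notin S, matchable el S,
    (forall b, b \in [set~ c] -> b \notin S ->
      exists2 Y, blocked el S b Y & forall x, x \in Y -> w x <= w b),
    s' vcnt 0 = #|S| & s' vwt 0 = \sum_(x in S) w x].
Proof.
move=> [sn sm si sE] hc hw hwD; rewrite /greedy; ev.
set s0 := put (put s _ _ _) _ _ _; set s1 := eval N (For _ _ _) s0.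
have Z x : x < m -> s1 vsel x = 0 /\ s1 vdone x = 0.
  apply: (For_ind (B := m) (I := fun k t => forall x, x < k -> t vsel x = 0 /\ t vdone x = 0)) => //.
  move=> k t hk htk _ IH {}x hx; ev; rewrite /put /upd /= htk.
  by case: eqP => // ne; apply: IH; lia.
have F1 v : vidx v != vidx vx -> vidx v != vidx vsel -> vidx v != vidx vdone -> s1 v = s0 v.
  by move=> a1 a2 a3; rewrite /s1 For_frame //= (negPf a2) (negPf a3).
set s2 := put s1 _ _ _ => /=.
have d2 : s2 vdone = upd (s1 vdone) c 1.
  by rewrite /s2 /put /= (F1 vctr) // -[s0 vctr 0]/(s vctr 0) hc.
have sl2 : s2 vsel = s1 vsel by [].
have inv0 : greedy_inv 0 s2.
  have E0 : selected s2 = set0.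
    by apply/setP => x; rewrite !inE sl2; have [-> _] := Z x (ltn_ord x).
  split; rewrite ?E0 ?sl2.
  - by move=> x; have [-> _] := Z x (ltn_ord x).
  - by move=> x y; have [-> _] := Z x (ltn_ord x).
  - by exists (fun=> i); split=> x; rewrite inE.
  - move=> b bc; rewrite d2 /upd ifN; last by rewrite val_eqE.
    by have [_ ->] := Z b (ltn_ord b).
  - by rewrite cards0 /s2 put_other // F1.
  - by rewrite big_set0 /s2 put_other // F1.
  - by rewrite subn0 (leq_trans (max_card _)) ?card_ord.
  - by rewrite d2 /upd eqxx.
have : greedy_inv m (eval N (For vs vm (pick;; If (EV vbest) try_best Skip)) s2).
  apply: (For_ind (B := m) (I := greedy_inv)) => //.
  - by rewrite /s2 put_other // F1.
  - exact: greedy_inv_ext inv0.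
  move=> k t hk htk Fr IH.
  apply: (@greedy_inv_ext _ (eval N (pick;; If (EV vbest) try_best Skip) t)) => //.
  have Ft v : vidx v != vidx vs -> ~~ writes (pick;; If (EV vbest) try_best Skip) v ->
      vidx v != vidx vx -> vidx v != vidx vsel -> vidx v != vidx vdone -> t v = s0 v.
    by move=> a1 a2 a3 a4 a5; rewrite Fr // /s2 put_other // F1.
  ev; set t1 := eval N pick t.
  have Ht : setting m s00 i t by split; rewrite Ft.
  have Ht1 : setting m s00 i t1 by apply: setting_frame.
  have [||||[p1 p2]|[b [hb p1 p2 p3 p4]]] := @pickP N t m w.
  - by case: Ht.
  - by [].
  - by move=> x hx; rewrite (Ft vim) // (Ft vU) //; apply: hw.
  - by move=> x hx; rewrite (Ft vT) // (Ft vU) //; apply: hwD.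
  - rewrite -/t1 in p1; rewrite eval_if /= p1 /=; ev.
    apply: (@greedy_inv_ext _ t) => //; try by rewrite /t1 eval_frame.
    have [h1 h2 h3 h4 h5 h6 h7 h8] := IH; split=> //.
    rewrite (_ : [set _ | _] = set0) ?cards0 //; apply/setP => x; rewrite !inE.
    by apply: negbTE; apply: p2.
  rewrite -/t1 in p1 p3; rewrite eval_if /= p1 /= /try_best; ev.
  pose bo : 'I_m := Ordinal hb.
  set t2 := put (put t1 _ _ _) _ _ _; set t3 := eval N test t2.
  have P1 v : ~~ writes pick v -> t1 v = t v by move=> h; rewrite /t1 eval_frame.
  have F3 v : ~~ writes test v -> t3 v = t2 v by move=> h; rewrite /t3 eval_frame.
  have dn : t2 vdone = upd (t vdone) b 1 by rewrite /t2 /put /= p1 subn1 P1.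
  have sl : t2 vsel = upd (t vsel) b 1 by rewrite /t2 /put /= p1 subn1 P1.
  have Ht2 : setting m s00 i t2 by case: Ht1.
  have best3 : t3 vbest 0 = b.+1 by rewrite F3.
  have sb : t vsel b = 0.
    by apply/eqP; apply: contraT => h; have [/eqP] := gi_done IH (x := bo) h.
  have ES : selected t2 = bo |: selected t.
    by apply/setP => x; rewrite !inE sl /upd -val_eqE /=; case: (nat_of_ord x =P b).
  rewrite eval_if /=; case: (testP nN mN Ht2); rewrite -/t3 => -[f1 f2]; rewrite f1 /=; ev.
    apply: (@reject_inv k t _ bo) => //; rewrite -?ES //.
    - by rewrite put_other // F3.
    - by rewrite /put /= best3 subn1 F3 // sl.
    - by rewrite put_other // F3 // /t2 !put_other // P1.
    - by rewrite put_other // F3 // /t2 !put_other // P1.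
  apply: (@accept_inv k t _ bo) => //.
  - by move=> x hx; apply: p4.
  - by rewrite !put_other // F3.
  - by rewrite !put_other // F3 // sl.
  - by rewrite put_other // put_same /= F3 // /t2 !put_other // P1 // addn1.
  - by rewrite put_same /= !put_other // !F3 // /t2 !put_other // P1 // p3.
  - rewrite (_ : selected _ = selected t2) //.
    by apply/setP => x; rewrite !inE !put_other // F3.
set s3 := eval N _ s2 => G; exists (selected s3); split.
- by rewrite inE; apply/negP => /(gi_done G) [_]; rewrite eqxx.
- exact: gi_match G.
- move=> b; rewrite !inE => bc; rewrite negbK => /eqP sb.
  (* After m rounds no item is pending, so an unselected leaf must have been rejected. *)
  apply: (gi_block G) => //; apply/eqP => db.
  by have := gi_left G; rewrite subnn leqn0 cards_eq0 => /eqP/setP/(_ b); rewrite !inE db eqxx.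
- exact: gi_cnt G.
- exact: gi_wt G.
Qed.

End Greedy.

Definition check : cmd :=
  If (neqE (EA (EV vcnt) (EC 1)) (EV vn)) Skip (
    Asg vacc (EC 0) ;; For vq vn (Asg vacc (EA (EV vacc) (EV vwt))) ;;
    Asg vr (EC 0) ;; For vq vn (Asg vr (EA (EV vr) (EG vU (EV vT)))) ;;
    If (ES (EA (EV vacc) (EG vU (EV vT))) (EV vr)) Skip (Asg vans (EC 1))).

Lemma checkP N s n D : s vn 0 = n -> n <= N -> s vU (s vT 0) = D ->
  eval N check s vans 0 =
  if ((s vcnt 0).+1 == n) && (n * s vwt 0 + D <= n * D) then 1 else s vans 0.
Proof.
move=> sn nN hD; rewrite /check eval_if neqE_eq0 /= sn addn1.
case: eqP => [_|_] /=; last by ev.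
ev; set s0 := put s _ _ _; set s1 := eval N (For _ _ _) s0.
set s2 := put s1 _ _ _; set s3 := eval N (For _ _ _) s2.
have E1 : s1 vacc 0 = n * s vwt 0.
  rewrite /s1 (@For_add N _ _ _ _ _ (s vwt 0)) ?[s0 vn 0]sn //.
  by move=> s' Fr /=; rewrite Fr.
have F1 v : vidx v != vidx vq -> vidx v != vidx vacc -> s1 v = s v.
  by move=> h1 h2; rewrite /s1 For_frame //= /s0 put_other.
have e2 : s2 vn 0 = n by rewrite /s2 put_other // F1.
have E3 : s3 vr 0 = n * D.
  rewrite /s3 (@For_add N _ _ _ _ _ D) ?e2 //.
  by move=> s' Fr /=; rewrite !Fr // /s2 !put_other // !F1.
have F3 v : vidx v != vidx vq -> vidx v != vidx vr -> s3 v = s1 v.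
  by move=> h1 h2; rewrite /s3 For_frame //= /s2 put_other.
rewrite eval_if /= E3 !F3 // E1 !F1 // hD subn_eq0.
case: leqP => _; ev; first by rewrite put_same.
by rewrite F3 // F1.
Qed.

Definition main_loop : cmd :=
  For vi vn (greedy ;; check ;; Asg vim (EA (EV vim) (EV vm))).

(** [vans] is raised but never lowered, so it accumulates the disjunction over the players i
    tried. *)
Lemma main_loopP N n m s (c : 'I_m) D : s vn 0 = n -> s vm 0 = m -> n <= N -> m <= N ->
  s vctr 0 = c -> s vim 0 = 0 -> s vans 0 = 0 -> s vU (s vT 0) = D ->
  (forall t, t < n * m -> s vU t <= D) ->
  eval N main_loop s vans 0 = 1 <->
  exists (i : 'I_n) (S : {set 'I_m}), [/\ c \notin S, matchable (@el n m s i) S,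
    #|S|.+1 = n & n * (\sum_(x in S) s vU (i * m + x)) + D <= n * D].
Proof.
move=> sn sm nN mN sc sim sans sD hD.
pose cond (i : 'I_n) := exists S : {set 'I_m}, [/\ c \notin S, matchable (@el n m s i) S,
    #|S|.+1 = n & n * (\sum_(x in S) s vU (i * m + x)) + D <= n * D].
pose I k (t : store) := t vim 0 = k * m /\ (t vans 0 = 1 <-> exists i : 'I_n, i < k /\ cond i).
suff : I n (eval N main_loop s).
  case=> _ H; apply: (iff_trans H).
  by split=> [[i [_ [S HS]]]|[i [S HS]]]; exists i; [exists S|split; [|exists S]].
apply: For_ind => //.
  by split=> //; rewrite put_other // sans; split=> // [[i []]].
move=> k t hk htk Fr; case=> tim tans; ev; set t1 := eval N greedy t; set t2 := eval N check t1.
pose i : 'I_n := Ordinal hk.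
have Ht : setting m s i t by split; rewrite ?(Fr vn) ?(Fr vm) ?(Fr vE).
have F1 v : ~~ writes greedy v -> t1 v = t v by move=> h; rewrite /t1 eval_frame.
have F2 v : ~~ writes check v -> t2 v = t1 v by move=> h; rewrite /t2 eval_frame.
have idx x : x < m -> k * m + x < n * m.
  by move=> hx; have : k.+1 * m <= n * m; [rewrite leq_mul2r hk orbT|rewrite mulSn; lia].
have [|||S [cS mS bS cntS wtS]] :=
    @greedyP N n m s i c (fun x => s vU (k * m + x)) nN mN t Ht.
- by rewrite Fr.
- by move=> x hx; rewrite Fr // tim.
- by move=> x hx; rewrite !(Fr vT) // Fr // sD; apply: hD; apply: idx.
rewrite -/t1 in cntS wtS.
have E2 : t2 vans 0 = if (#|S|.+1 == n) && (n * (\sum_(x in S) s vU (k * m + x)) + D <= n * D)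
    then 1 else t vans 0.
  rewrite /t2 (@checkP N t1 n D) ?cntS ?wtS ?F1 //; first by rewrite Fr.
  by rewrite !Fr.
rewrite /I /put /upd /=; split.
  by rewrite F2 // F1 // tim F2 // F1 // Fr // sm mulSn addnC.
have condi : cond i <-> (#|S|.+1 == n) && (n * (\sum_(x in S) s vU (k * m + x)) + D <= n * D).
  split; last by move=> /andP [/eqP h1 h2]; exists S.
  move=> [T [cT mT nT hT]].
  have sT : T \subset [set~ c].
    by apply/subsetP => x xT; rewrite !inE; apply: contraNneq cT => <-.
  have [h1 h2] := greedy_optimal mS mT sT bS.
  (* Player i is never matched, so S has at most n-1 leaves; a feasible T has n-1 and is no larger
     than S, hence the sizes agree and the weights can be compared. *)
  have hS : #|S|.+1 <= n.
    have [f [fI fel]] := mS; rewrite -(card_in_imset fI).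
    have : f @: S \subset [set~ i].
      apply/subsetP => _ /imsetP [x xS ->]; rewrite !inE.
      by have /andP [] := fel x xS.
    move/subset_leq_card; rewrite cardsC1 card_ord -ltnS prednK //.
    exact: (leq_ltn_trans (leq0n k) hk).
  have eS : #|S|.+1 = n by lia.
  rewrite eS eqxx /=; apply: leq_trans hT; rewrite leq_add2r leq_mul2l.
  by apply/orP; right; apply: h2; lia.
rewrite E2; case: ifP => hc.
  split=> // _; exists i; split=> //; exact/condi.
split=> [/tans [j [hj cj]]|[j [hj cj]]]; first by exists j; split=> //; apply: ltnW.
apply/tans; exists j; split=> //; rewrite ltnS leq_eqVlt in hj; case/predU1P: hj => // Ej.
have Eij : j = i by apply: val_inj.
by move: cj; rewrite Eij => /condi; rewrite hc.
Qed.

(** The closing test answers yes for n = 0, where the main loop tries no player. *)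
Definition cfd_cmd : cmd :=
  get_bound ;; dims ;; powers ;; center ;; normalize ;; eligible ;; main_loop ;;
  If (EV vn) Skip (Asg vans (EC 1)).

(** * Layout of the encoded instance and final assembly *)

Lemma nth_flatten_uniform (A B : Type) (a : A) (d : B) (F : A -> seq B) k s i r :
  (forall x, size (F x) = k) -> i < size s -> r < k ->
  nth d (flatten [seq F x | x <- s]) (i * k + r) = nth d (F (nth a s i)) r.
Proof.
move=> hF; elim: s i => // x s IH [|i] hi hr /=; rewrite nth_cat hF.
  by rewrite mul0n add0n hr.
rewrite (_ : i.+1 * k + r < k = false); last by rewrite mulSn; lia.
by rewrite -IH //; congr nth; rewrite mulSn; lia.
Qed.

Lemma size_flatten_uniform (A B : Type) (F : A -> seq B) k s :
  (forall x, size (F x) = k) -> size (flatten [seq F x | x <- s]) = size s * k.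
Proof. by move=> hF; elim: s => //= x s IH; rewrite size_cat hF IH mulSn. Qed.

Section Encode.
Variables (n m : nat) (e : rel 'I_m) (u : 'I_n -> 'I_m -> rat).

Definition frac (i : 'I_n) (v : 'I_m) : seq nat :=
  [:: absz (numq (u i v)); absz (denq (u i v))].

(** Rebracketing the fractions by player gives blocks of equal length at every level, so positions
    can be computed by [nth_flatten_uniform]. *)
Lemma encodeE : encode e u = [:: n; m] ++
  flatten [seq [seq nat_of_bool (e x y) | y <- enum 'I_m] | x <- enum 'I_m] ++
  flatten [seq flatten [seq frac i v | v <- enum 'I_m] | i <- enum 'I_n].
Proof.
rewrite /encode; congr (_ ++ (_ ++ _)); elim: (enum 'I_n) => //= i s IH.
by rewrite flatten_cat IH.
Qed.

Lemma size_frac_row i : size (flatten [seq frac i v | v <- enum 'I_m]) = m * 2.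
Proof. by rewrite (@size_flatten_uniform _ _ _ 2) // size_enum_ord. Qed.

Lemma size_adj_row x : size [seq nat_of_bool (e x y) | y <- enum 'I_m] = m.
Proof. by rewrite size_map size_enum_ord. Qed.

Lemma size_encode : size (encode e u) = 2 + m * m + 2 * (n * m).
Proof.
rewrite encodeE !size_cat (size_flatten_uniform _ size_adj_row).
rewrite (size_flatten_uniform _ size_frac_row) !size_enum_ord /=; lia.
Qed.

Lemma nth_encode_adj (x y : 'I_m) :
  nth 0 (encode e u) (2 + x * m + y) = e x y.
Proof.
rewrite encodeE -addnA /= nth_cat.
rewrite (size_flatten_uniform _ size_adj_row) size_enum_ord.
have -> : x * m + y < m * m.
  have := ltn_ord y; have : x.+1 * m <= m * m by rewrite leq_mul2r ltn_ord orbT.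
  by rewrite mulSn; lia.
rewrite (nth_flatten_uniform x _ size_adj_row) ?size_enum_ord //.
by rewrite (nth_map y) ?size_enum_ord // !nth_ord_enum.
Qed.

Lemma nth_encode_frac (i : 'I_n) (v : 'I_m) r : r < 2 ->
  nth 0 (encode e u) (2 + m * m + ((i * m + v) * 2 + r)) = nth 0 (frac i v) r.
Proof.
move=> hr; rewrite encodeE -addnA /= nth_cat.
rewrite (size_flatten_uniform _ size_adj_row) size_enum_ord ltnNge leq_addr /= add0n addKn.
have -> : (i * m + v) * 2 + r = i * (m * 2) + (v * 2 + r) by lia.
have hv : v * 2 + r < m * 2 by have := ltn_ord v; lia.
rewrite (nth_flatten_uniform i _ size_frac_row) ?size_enum_ord //.
rewrite (@nth_flatten_uniform _ _ v _ _ 2) ?size_enum_ord //.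
by rewrite !nth_ord_enum.
Qed.

End Encode.

Lemma prod_except (T : nat) (den : nat -> nat) t : t < T ->
  den t * \prod_(q < T) (if q == t :> nat then 1 else den q) = \prod_(q < T) den q.
Proof.
move=> ht; rewrite (bigD1 (Ordinal ht)) //= eqxx mul1n [RHS](bigD1 (Ordinal ht)) //=.
by congr muln; apply: eq_bigr => q qt; rewrite ifN.
Qed.

Import Order.TTheory GRing.Theory Num.Theory.

Lemma scaled_utility (num den U D : nat) (q : rat) :
  den = absz (denq q) -> num = absz (numq q) -> (0 <= q)%R ->
  den * U = num * D -> (U%:R = q * D%:R :> rat)%R.
Proof.
move=> hd hn q0 E; have d0 : (den%:R != 0 :> rat)%R.
  by rewrite pnatr_eq0 hd absz_eq0 denq_neq0.
apply: (mulfI d0); rewrite -natrM E natrM mulrA; congr (_ * _)%R.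
have hq : (q = num%:R / den%:R)%R.
  rewrite -[LHS]divq_num_den hd hn; congr (_ / _)%R.
    by rewrite -[numq q]gez0_abs ?numq_ge0.
  by rewrite -[denq q]gez0_abs ?denq_ge0.
by rewrite hq mulrC divfK.
Qed.

Lemma cfd_cmdP N n m (e : rel 'I_m) (u : 'I_n -> 'I_m -> rat) (s : store) :
  is_star e -> utilities u -> size (encode e u) <= N ->
  (forall k, k < size (encode e u) -> k != 2 -> nth 0 (encode e u) k < 2 ^ N) ->
  (forall k, k < size (encode e u) -> k != 2 -> s vW k.+1 = nth 0 (encode e u) k) ->
  (forall v j, vidx v != 0 -> s v j = 0) ->
  eval N cfd_cmd s vans 0 = 1 <-> has_prop_allocation e u.
Proof.
move=> He Hu; rewrite size_encode => LN HN HW H0; have [c0 Hc0] := He.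
have m0 : 0 < m := leq_ltn_trans (leq0n c0) (ltn_ord c0).
have mm0 : 0 < m * m by rewrite muln_gt0 m0.
have mm_m : m <= m * m by rewrite leq_pmulr.
have nm_n : n <= n * m by rewrite leq_pmulr.
have Wn : s vW 1 = n by rewrite HW.
have Wm : s vW 2 = m by rewrite HW.
rewrite /cfd_cmd; ev.
set s1 := eval N get_bound s; set s2 := eval N dims s1; set s3 := eval N powers s2.
set s4 := eval N center s3; set s5 := eval N normalize s4; set s6 := eval N eligible s5.
set s7 := eval N main_loop s6.
have F1 v : ~~ writes get_bound v -> s1 v = s v by move=> h; rewrite /s1 eval_frame.
have F2 v : ~~ writes dims v -> s2 v = s1 v by move=> h; rewrite /s2 eval_frame.
have F3 v : ~~ writes powers v -> s3 v = s2 v by move=> h; rewrite /s3 eval_frame.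
have F4 v : ~~ writes center v -> s4 v = s3 v by move=> h; rewrite /s4 eval_frame.
have F5 v : ~~ writes normalize v -> s5 v = s4 v by move=> h; rewrite /s5 eval_frame.
have F6 v : ~~ writes eligible v -> s6 v = s5 v by move=> h; rewrite /s6 eval_frame.
have F7 v : ~~ writes main_loop v -> s7 v = s6 v by move=> h; rewrite /s7 eval_frame.
have N1 : s1 vN 0 = N by rewrite /s1 get_boundP H0.
have [n2 m2 T2 mm2 T12] : [/\ s2 vn 0 = n, s2 vm 0 = m, s2 vT 0 = n * m,
    s2 vmm 0 = m * m & s2 vT1 0 = (n * m).+1].
  have [||||] := @dimsP N s1; rewrite !F1 ?Wn ?Wm ?H0 //; lia.
have P3 : pow_table N s3 by apply: powersP; rewrite F2.
have n3 : s3 vn 0 = n by rewrite F3.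
have m3 : s3 vm 0 = m by rewrite F3.
have W3 : s3 vW = s vW by rewrite F3 // F2 // F1.
have W3e (x y : 'I_m) : y != x -> s3 vW (3 + x * m + y) = e x y.
  move=> yx; rewrite W3 (_ : 3 + x * m + y = (2 + x * m + y).+1); last lia.
  have hxy : x * m + y < m * m.
    have := ltn_ord y; have : x.+1 * m <= m * m by rewrite leq_mul2r ltn_ord orbT.
    by rewrite mulSn; lia.
  rewrite HW ?nth_encode_adj // -?addnA; first lia.
  (* Word 2, the one lost in relocation, is the entry (0,0), and this one is diagonal. *)
  apply/negP => /eqP E; case/negP: yx; apply/eqP/val_inj => /=.
  have [y0 x0] : nat_of_ord y = 0 /\ x * m = 0 by lia.
  by move/eqP: x0; rewrite muln_eq0 y0 => /orP [/eqP ->//|]; rewrite eqn0Ngt m0.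
have [hc Hc] : s4 vctr 0 < m /\ full_row s3 m (s4 vctr 0).
  have := @centerP N s3; rewrite m3; apply; first lia.
  exists c0 => // y hy yc; rewrite (W3e c0 (Ordinal hy)) ?Hc0 ?eqxx -?val_eqE //=.
  by rewrite yc.
pose c : 'I_m := Ordinal hc.
have Hstar : star_at e c.
  apply: star_at_center He _ => y yc.
  by have := Hc y (ltn_ord y) yc; rewrite (W3e c) //; case: (e c y).
pose num t := s4 vW (3 + s4 vmm 0 + (t + t)).
pose den t := s4 vW (4 + s4 vmm 0 + (t + t)).
have W4 : s4 vW = s vW by rewrite F4.
have mm4 : s4 vmm 0 = m * m by rewrite F4 // F3.
have hidx (i : 'I_n) (v : 'I_m) : i * m + v < n * m.
  have := ltn_ord v; have : i.+1 * m <= n * m by rewrite leq_mul2r ltn_ord orbT.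
  by rewrite mulSn; lia.
have numE (i : 'I_n) (v : 'I_m) : num (i * m + v) = absz (numq (u i v)).
  have h := hidx i v; rewrite /num W4 mm4.
  rewrite (_ : 3 + _ + _ = (2 + m * m + ((i * m + v) * 2 + 0)).+1); last lia.
  by rewrite HW ?nth_encode_frac //; lia.
have denE (i : 'I_n) (v : 'I_m) : den (i * m + v) = absz (denq (u i v)).
  have h := hidx i v; rewrite /den W4 mm4.
  rewrite (_ : 4 + _ + _ = (2 + m * m + ((i * m + v) * 2 + 1)).+1); last lia.
  by rewrite HW ?nth_encode_frac //; lia.
have decode t : t < n * m -> exists i : 'I_n, exists v : 'I_m, t = i * m + v.
  move=> ht; have hi : t %/ m < n by rewrite ltn_divLR.
  have hv : t %% m < m by rewrite ltn_mod.
  by exists (Ordinal hi), (Ordinal hv); rewrite /= -divn_eq.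
have den_lt t : t < n * m -> den t < 2 ^ N.
  move=> ht; rewrite /den W4 mm4.
  rewrite (_ : 4 + _ + _ = (2 + m * m + (t * 2 + 1)).+1); last lia.
  by rewrite HW ?HN //; lia.
have P4 : pow_table N s4 by case: P3 => p1 p2; split=> [|k hk]; rewrite F4 // p2.
have U5 t : t <= n * m -> s5 vU t = (if t < n * m then num t else 1) *
    \prod_(q < n * m) (if q == t :> nat then 1 else den q).
  by apply: normalizeP => //; rewrite ?F4 // ?F3 //; lia.
clearbody s1 s2 s3 s4 s5.
pose D := \prod_(q < n * m) den q.
have UD : s5 vU (n * m) = D.
  rewrite U5 // ltnn mul1n; apply: eq_bigr => q _.
  by rewrite ltn_eqF.
have D0 : 0 < D.
  rewrite /D prodn_gt0 // => q; have [i [v ->]] := decode q (ltn_ord q).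
  by rewrite denE absz_gt0 denq_neq0.
have [u0 u1] := Hu.
pose U (i : 'I_n) (v : 'I_m) := s5 vU (i * m + v).
have UE i v : ((U i v)%:R = u i v * D%:R :> rat)%R.
  have h := hidx i v.
  apply: (@scaled_utility (num (i * m + v)) (den (i * m + v))) => //.
  rewrite /U U5 ?h; last exact: ltnW.
  by rewrite mulnCA prod_except.
have U_le t : t < n * m -> s5 vU t <= D.
  move=> /decode [i [v ->]]; rewrite -[s5 vU _]/(U i v) -(ler_nat rat) UE.
  rewrite -[leRHS]mul1r ler_wpM2r ?ler0n // -(u1 i) (bigD1 v) //= lerDl.
  by apply: sumr_ge0.
have E6 t : t < n * m -> (s6 vE t != 0) = (D <= n * s5 vU t).
  move=> ht; rewrite -UD; apply: (@eligibleP N s5 n (n * m)) => //.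
  - by rewrite F5 // F4.
  - by rewrite F5 // F4 // F3.
  - by lia.
  - by lia.
have U6 : s6 vU = s5 vU by rewrite F6.
have n6 : s6 vn 0 = n by rewrite F6 // F5 // F4.
have M := @main_loopP N n m s6 c D.
have {}M : s7 vans 0 = 1 <-> exists (i : 'I_n) (S : {set 'I_m}), [/\ c \notin S,
    matchable (@el n m s6 i) S, #|S|.+1 = n &
    n * (\sum_(x in S) s6 vU (i * m + x)) + D <= n * D].
  apply: M => //.
  - by rewrite F6 // F5 // F4.
  - by lia.
  - by lia.
  - by rewrite F6 // F5.
  - by rewrite F6 // F5 // F4 // F3 // F2 // F1 // H0.
  - by rewrite F6 // F5 // F4 // F3 // F2 // F1 // H0.
  - by rewrite U6 (F6 vT) // (F5 vT) // F4 // F3 // T2.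
  - by rewrite U6.
apply: (iff_trans _ (iff_sym (star_allocation_scaled Hstar Hu D0 UE))).
rewrite eval_if /= F7 // n6; have [n0|n0] := posnP n.
  by ev; rewrite put_same /=; split=> // _; left.
ev; apply: (iff_trans M); split.
  move=> [i [S [h1 [f [fI fe]] h3 h4]]]; right; exists i, S; split=> //.
    exists f; split=> // x /fe; rewrite /el /elig E6 //.
  by move: h4; rewrite U6.
move=> [h|[i [S [h1 [f [fI fe]] h3 h4]]]]; first by rewrite h in n0.
exists i, S; split=> //; last by rewrite U6.
by exists f; split=> // x /fe; rewrite /el /elig E6.
Qed.

(** 83 is the length of [prelude]; the answer is evaluated into register 3 and then moved to cell 0,
    where the verdict is read. *)
Definition cfd_program : program :=
  prelude ++ ccode cfd_cmd 3 83 ++ ecode (EV vans) 3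
  ++ [:: Const 0 0; Add 0 0 3; Halt].

(** For positive x, N+1 is at most 4x; the additive term takes care of x = 0. *)
Lemma poly_rescale C k x N : N <= 2 * x -> C * N.+1 ^ k <= C * 4 ^ k * x ^ k + C * 4 ^ k.
Proof.
move=> hN; rewrite -mulnA -mulnDr leq_mul2l; apply/orP; right.
case: x hN => [|x] hN.
  have -> : N = 0 by lia.
  by rewrite exp1n (leq_trans _ (leq_addl _ _)) // expn_gt0.
by apply: leq_trans (leq_addr _ _); rewrite -expnMn; case: k => // k; rewrite leq_exp2r //; lia.
Qed.

Theorem theorem2 :
  exists (P : program) (c k : nat),
    forall (n m : nat) (e : rel 'I_m) (u : 'I_n -> 'I_m -> rat),
      simple_graph e -> is_star e -> utilities u ->
      decides_within P (encode e u) (c * (insize (encode e u)) ^ k + c)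
        (has_prop_allocation e u).
Proof.
have [C [k HC]] := cost_poly cfd_cmd.
(* 200 covers the prelude and the final moves; the exponent exceeds k so that it dominates the
   linear copying cost even when k = 0. *)
exists cfd_program, (200 + C * 4 ^ k), k.+1 => n m e u _ He Hu.
set w := encode e u; set I := insize w.
have Hp : code_at cfd_program 0 cfd_program by move=> i _.
have [base [N [M [s [R1 [lb HR] [N1 N2 N3] sW s0]]]]] := @prelude_ok _ w (code_at_catl Hp).
have Hp1 := code_at_catr Hp; rewrite add0n size_prelude in Hp1.
(* Code uses registers from 3 on; that [cfd_cmd] fits below [low] is checked by computation. *)
have [||M2 [R2 HR2 _]] := ccode_ok lb (code_at_catl Hp1) HR => //.
have Hp2 := code_at_catr Hp1; rewrite size_ccode in Hp2.
have [||M3 [R3 V3 _]] := ecode_ok lb (code_at_catl Hp2) HR2 => //.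
have := code_at_catr Hp2; rewrite size_ecode; set p := 83 + _ + _ => Hp3.
have [_ Hp4] := code_at_cons Hp3; have [_ Hp5] := code_at_cons Hp4.
have [hh _] := code_at_cons Hp5.
have R4 := reach_straight M3 (@code_at_catl _ _ [:: Const 0 0; Add 0 0 3] [:: Halt] Hp3) isT.
have R := reach_trans R1 (reach_trans R2 (reach_trans R3 R4)).
have hstop : nth Halt cfd_program (p + size [:: Const 0 0; Add 0 0 3]) = Halt.
  by rewrite [size _]/= addn2.
exists (foldl exec1 M3 [:: Const 0 0; Add 0 0 3]); split.
  apply: run_reach (reach_le _ R) _; last by rewrite /step [pc _]/pc hstop.
  have I0 : 0 < I by rewrite /I /insize /w /encode /= big_cons.
  have := HC N; have := poly_rescale C k N2; rewrite -/I.
  have : I ^ k <= I ^ k.+1 by rewrite leq_pexp2l.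
  have : I <= I ^ k.+1 by rewrite -[leqLHS]expn1 leq_pexp2l.
  move: (cost N cfd_cmd) (I ^ k) (I ^ k.+1) (C * N.+1 ^ k) (C * 4 ^ k) => a b d f g.
  rewrite [size _]/= [esize _]/=; clear; nia.
rewrite /= /upd /= V3 /=.
exact: (cfd_cmdP He Hu N1 N3 sW s0).
Qed.
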